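(* Let $p\colon E\to B$ be a smooth locally trivial map of manifolds with compact fiber. Let $K$ be a compact subset of $B$, let $S\subseteq\partial B$, and let $T=p^{-1}(S)$. Then the map $\operatorname{Diff}_f^{p^{-1}(K)}(E\ \mathrm{rel}\ T)\to\operatorname{Diff}^K(B\ \mathrm{rel}\ S)$ that sends a fiber-preserving diffeomorphism to the diffeomorphism of $B$ that it induces is locally trivial.
   Context: Manifolds are smooth and may have boundary; when both $B$ and the fiber have nonempty boundary, $E$ is a manifold with corners. All diffeomorphism groups carry the $C^\infty$-topology. $\operatorname{Diff}_f(E)$ is the group of diffeomorphisms of $E$ that take each fiber of $p$ to a fiber of $p$. For a subset $X$ and a subset $K$ of a manifold $N$, $\operatorname{Diff}^K(N\ \mathrm{rel}\ X)$ is the group of diffeomorphisms of $N$ that are the identity on $X\cup(N-K)$; $\operatorname{Diff}_f^{p^{-1}(K)}(E\ \mathrm{rel}\ T)$ is the group of elements of $\operatorname{Diff}_f(E)$ that are the identity on $T\cup(E-p^{-1}(K))$. A map $\pi\colon Y\to X$ is locally trivial if each $x_0\in X$ has a neighborhood $U$ with a homeomorphism $\pi^{-1}(U)\cong U\times\pi^{-1}(x_0)$ over $U$ (fibers are allowed to be empty, so surjectivity is not asserted).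
   Formalization: The map p is assumed surjective (no empty fibers): off p(E) a fiber-preserving diffeomorphism induces nothing on B, and with the identity there the claim fails (B two lines, E one of them, K an interval in the other). *)

(* Defs.v *)
From HB Require Import structures.
From mathcomp Require Import all_boot all_order all_algebra.
From mathcomp Require Import all_classical all_reals all_analysis.

Set Implicit Arguments.
Unset Strict Implicit.
Unset Printing Implicit Defensive.
Import Order.TTheory GRing.Theory Num.Theory.
Import numFieldNormedType.Exports.
Local Open Scope classical_set_scope.
Local Open Scope ring_scope.

(* Calculus on a relatively open subset A of a sector of R^n.  The partial
   derivatives only use increments that stay in A, so they are one-sided at
   boundary points in the constrained directions. *)
Section Calculus.
Context {R : realType} {n : nat}.
Implicit Types (A : set 'rV[R]_n) (f : 'rV[R]_n -> R) (x : 'rV[R]_n).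

Definition sector (J : {set 'I_n}) : set 'rV[R]_n :=
  [set x | forall i, i \in J -> 0 <= x 0 i].

Definition diff_quot f x (i : 'I_n) (h : R) : R :=
  h^-1 * (f (x + h *: delta_mx 0 i) - f x).

Definition increments A x (i : 'I_n) : set_system R :=
  within [set h | A (x + h *: delta_mx 0 i)] 0^'.

Definition partial A (i : 'I_n) f x : R :=
  lim (diff_quot f x i @ increments A x i).

(* The iterated partial derivative d_{w_1} d_{w_2} ... f. *)
Definition partials A (w : seq 'I_n) f : 'rV[R]_n -> R :=
  foldr (partial A) f w.

(* C^oo up to the boundary: all iterated partial derivatives exist and are
   continuous on A; by Whitney and Seeley this amounts to the existence of local
   C^oo extensions to open subsets of R^n. *)
Definition Cinfty A f : Prop :=
  forall w : seq 'I_n,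
    {within A, continuous (partials A w f)} /\
    forall i x, A x -> cvg (diff_quot (partials A w f) x i @ increments A x i).

End Calculus.

(* A chart with values in the sector {x | x_i >= 0 for i in cset}.  cfun and cinv
   are total functions; their values outside cdom and cfun @` cdom are junk. *)
Record chart (R : realType) (M : topologicalType) (n : nat) := Chart {
  cdom : set M;
  cset : {set 'I_n};
  cfun : M -> 'rV[R]_n;
  cinv : 'rV[R]_n -> M }.

Definition is_chart (R : realType) (M : topologicalType) (n : nat)
    (c : chart R M n) : Prop :=
  [/\ open (cdom c),
      exists2 O : set 'rV[R]_n, open O & cfun c @` cdom c = O `&` sector (cset c),
      forall x, cdom c x -> cinv c (cfun c x) = x,
      {within cdom c, continuous (cfun c)} &
      {within cfun c @` cdom c, continuous (cinv c)}].

Definition atlas (R : realType) (M : topologicalType) (n : nat) :=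
  set (chart R M n).

Section SmoothMaps.
Context {R : realType} {M N : topologicalType} {m n : nat}.
Implicit Types (c : chart R M m) (d : chart R N n) (f : M -> N) (W : set M).

Definition rep_dom c d W f : set 'rV[R]_m :=
  cfun c @` (W `&` cdom c `&` f @^-1` cdom d).

Definition rep c d f (j : 'I_n) (v : 'rV[R]_m) : R :=
  cfun d (f (cinv c v)) 0 j.

(* Intended for W open. *)
Definition smooth_on (AM : atlas R M m) (AN : atlas R N n) W f : Prop :=
  {within W, continuous f} /\
  forall c d j, AM c -> AN d -> Cinfty (rep_dom c d W f) (rep c d f j).

End SmoothMaps.

Section Manifolds.
Context {R : realType} {M : topologicalType} {n : nat}.
Implicit Types A : atlas R M n.

(* The last clause is the smoothness of all transition maps. *)
Definition manifold_with_corners A : Prop :=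
  [/\ hausdorff_space M, @second_countable M,
      A `<=` @is_chart R M n,
      \bigcup_(c in A) cdom c = [set: M] &
      smooth_on A A [set: M] idfun].

Definition manifold_with_boundary A : Prop :=
  manifold_with_corners A /\ forall c, A c -> (#|cset c| <= 1)%N.

Definition boundary A : set M :=
  [set x | exists2 c, A c &
     cdom c x /\ exists2 i, i \in cset c & cfun c x 0 i = 0].

End Manifolds.

Definition chart_prod (R : realType) (M N : topologicalType) (m n : nat)
    (c : chart R M m) (d : chart R N n) : chart R (M * N)%type (m + n) :=
  {| cdom := cdom c `*` cdom d;
     cset := [set k : 'I_(m + n) | match fintype.split k with
                      | inl i => i \in cset c
                      | inr j => j \in cset d
                      end]%SET;
     cfun := fun z => row_mx (cfun c z.1) (cfun d z.2);
     cinv := fun v => (cinv c (lsubmx v), cinv d (rsubmx v)) |}.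

Definition atlas_prod (R : realType) (M N : topologicalType) (m n : nat)
    (A : atlas R M m) (A' : atlas R N n) : atlas R (M * N)%type (m + n) :=
  [set chart_prod c d | c in A & d in A'].

(* Local triviality is taken in the smooth category: over a neighbourhood U of b there is
   a diffeomorphism t (with inverse s) from p^-1(U) onto U * F over U, where F
   is a compact manifold, possibly with boundary; F may depend on b. *)
Definition smooth_bundle_with_compact_fiber (R : realType)
    (E B : topologicalType) (e n : nat)
    (AE : atlas R E e) (AB : atlas R B n) (p : E -> B) : Prop :=
  smooth_on AE AB [set: E] p /\
  forall b : B, exists (U : set B) (k : nat) (F : topologicalType)
                       (AF : atlas R F k) (t : E -> B * F) (s : B * F -> E),
    [/\ open_nbhs b U,
        manifold_with_boundary AF /\ compact [set: F],
        (forall x, U (p x) -> (t x).1 = p x /\ s (t x) = x),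
        (forall z, U z.1 -> p (s z) = z.1 /\ t (s z) = z) &
        smooth_on AE (atlas_prod AB AF) (p @^-1` U) t /\
        smooth_on (atlas_prod AB AF) AE (U `*` [set: F]) s].

Record diffeo (R : realType) (M : topologicalType) (n : nat)
    (A : atlas R M n) := Diffeo {
  dfun :> M -> M;
  diffeoP : smooth_on A A [set: M] dfun /\
    exists2 g : M -> M, smooth_on A A [set: M] g & cancel dfun g /\ cancel g dfun }.

HB.instance Definition _ (R : realType) (M : topologicalType) (n : nat)
  (A : atlas R M n) := gen_eqMixin (diffeo A).
HB.instance Definition _ (R : realType) (M : topologicalType) (n : nat)
  (A : atlas R M n) := gen_choiceMixin (diffeo A).

(* The (compact-open) C^oo topology: a subbasic neighbourhood of f is given by
   charts c, d, a compact set L in the domain of c with f(L) in the domain of d,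
   an order k and eps > 0; it consists of the g with g(L) in the domain of d
   whose local representative is eps-close to that of f on cfun c @` L,
   together with all partial derivatives of order at most k. *)
Section CinftyTopology.
Context {R : realType} {M : topologicalType} {n : nat} (A : atlas R M n).

Definition Cinfty_nbhd (f : diffeo A) (c d : chart R M n) (L : set M)
    (k : nat) (eps : R) : set (diffeo A) :=
  [set g : diffeo A | L `<=` g @^-1` cdom d /\
     forall (w : seq 'I_n) (j : 'I_n) x, (size w <= k)%N -> L x ->
       `| partials (rep_dom c d [set: M] g) w (rep c d g j) (cfun c x)
        - partials (rep_dom c d [set: M] f) w (rep c d f j) (cfun c x) | < eps].

Definition Cinfty_subbase : set (set (diffeo A)) :=
  [set V | exists (f : diffeo A) c d L k eps,
     [/\ A c /\ A d, compact L, L `<=` cdom c `&` f @^-1` cdom d, 0 < eps &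
         V = Cinfty_nbhd f c d L k eps]].

HB.instance Definition _ :=
  isSubBaseTopological.Build (diffeo A) Cinfty_subbase idfun.

End CinftyTopology.

(* The following sets of diffeomorphisms, seen as types, carry the subspace
   topology. *)

Definition Diff_rel (R : realType) (M : topologicalType) (n : nat)
    (A : atlas R M n) (K X : set M) : set (diffeo A) :=
  [set g : diffeo A | forall x, (X `|` ~` K) x -> g x = x].
Arguments Diff_rel {R M n} A K X.

Definition Diff_fiber (R : realType) (E B : topologicalType) (n : nat)
    (A : atlas R E n) (p : E -> B) : set (diffeo A) :=
  [set g : diffeo A | forall b, exists b',
     g @` (p @^-1` [set b]) = p @^-1` [set b']].
Arguments Diff_fiber {R E B n} A p.

Definition Diff_fiber_rel (R : realType) (E B : topologicalType) (n : nat)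
    (A : atlas R E n) (p : E -> B) (K X : set E) : set (diffeo A) :=
  Diff_fiber A p `&` Diff_rel A K X.
Arguments Diff_fiber_rel {R E B n} A p K X.

(* U and the fibers carry the subspace topology; the fibers may be empty. *)
Definition locally_trivial (Y X : topologicalType) (pi : Y -> X) : Prop :=
  forall x0 : X, exists2 U : set X, nbhs x0 U &
    exists (h : pi @^-1` U -> U * (pi @^-1` [set x0]))
           (k : U * (pi @^-1` [set x0]) -> pi @^-1` U),
      [/\ continuous h, continuous k, cancel h k, cancel k h &
          forall y, set_val (h y).1 = pi (set_val y)].

(* Main.v *)
(* A section of the induced map over a neighbourhood of a diffeomorphism f0 of B needs no
   connection, flow or inverse function theorem.  It is enough to move, smoothly and
   invertibly, the fibre over a to the fibre over b whenever a and b are close: given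
   such transports T(a, b), a fibre-preserving g over f near f0 corresponds to
   T(f0 b, f b)^-1 g over f0.  Over a compact K the transport is a composition of
   finitely many elementary moves: a path a = b_0, ..., b_m = b is built by going from
   b_(i-1) towards b along a segment of the i-th chart (sectors are convex), for a
   proportion rho_i(a) of the way, where rho_i is a bump function and the rho_i = 1 cover
   K; each step is followed in the fibres by the i-th trivialization, or by the identity
   where rho_i(a) = 0.

   All continuity statements in the C^oo topology are handled by one notion: a family
   P * M -> N with parameters in a topological space P is smooth when its partial
   derivatives in the M-directions are jointly continuous.  A map from P to the
   diffeomorphisms is continuous exactly when it is a smooth family, and smooth
   families compose by a parametrized chain rule. *)
Require Import Defs.
From mathcomp Require Import all_boot all_order all_algebra.
From mathcomp Require Import all_classical all_reals all_analysis finmap.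
From mathcomp Require Import ring lra.
Import numFieldNormedType.Exports.
Import Order.TTheory GRing.Theory Num.Theory.
Local Open Scope classical_set_scope.
Local Open Scope ring_scope.
Set Implicit Arguments.
Unset Strict Implicit.
Unset Printing Implicit Defensive.

(** * Germs of functions on sectors, with parameters *)

(** Two obstacles shape the details. On a sector only one-sided partial derivatives are given and
    there is no total derivative, so the chain rule rests on a mean value argument along a staircase
    of coordinate segments inside the sector. And a transport [T (a, b)] makes sense only on points
    over [a]; pairs of a point with such data form a set without an atlas. Its smoothness is
    therefore tested on smooth families [al], [be], [ep] with [p (ep y) = al y], which is the form
    in which it is applied.

    A composite of moves need not end at [b]. Its true endpoint [q (a, b)] is kept: it is [b] when
    [a] lies in the set already covered, and [a] when [b = a]. This suffices, since outside [K] two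
    elements of [Diff_rel] are both the identity. As [T (a, a)] is the identity on the fibre over
    [a], transport does not disturb the points that must stay fixed.

    The map of the base induced by a fibre-preserving diffeomorphism is smooth because it is locally
    a composition with a section of [p]; the same computation with a parameter shows that it depends
    continuously on the diffeomorphism. *)

Lemma cvg_rV {R : realType} {n : nat} {T : Type} (F : set_system T) {FF : Filter F}
    (f : T -> 'rV[R]_n) (v : 'rV[R]_n) :
  (forall j, f t 0 j @[t --> F] --> v 0 j) -> f @ F --> v.
Proof.
move=> fv; apply/cvg_ballP => e e0.
have : \forall t \near F, forall j, ball (v 0 j) e (f t 0 j).
  by apply: filter_forall => j; have /cvg_ballP := fv j; exact.
by apply: filterS => t ft; split => // i j; rewrite (ord1 i); exact: ft.
Qed.

Lemma cvg_coord {R : realType} {n : nat} {T : Type} (F : set_system T) {FF : Filter F}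
    (f : T -> 'rV[R]_n) (v : 'rV[R]_n) j :
  f @ F --> v -> f t 0 j @[t --> F] --> v 0 j.
Proof. by move=> fv; exact: (cvg_comp _ _ fv (@coord_continuous _ _ _ 0 j v)). Qed.

Lemma cvg_to_pair {T : Type} {U V : topologicalType} (F : set_system T) {FF : Filter F}
    (f : T -> U * V) (z : U * V) :
  (f t).1 @[t --> F] --> z.1 -> (f t).2 @[t --> F] --> z.2 -> f @ F --> z.
Proof.
move=> f1 f2 Q [[A B] /= [nA nB] AB].
have fA : F [set t | A (f t).1] := f1 _ nA.
have fB : F [set t | B (f t).2] := f2 _ nB.
suff : F [set t | Q (f t)] by [].
by apply: filterS2 fA fB => t At Bt; exact: (AB (f t) (conj At Bt)).
Qed.

Lemma near_cvg {T U : Type} {F : set_system T} {G : set_system U} (f : T -> U) (Q : set U) :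
  f @ F --> G -> (\forall y \near G, Q y) -> \forall t \near F, Q (f t).
Proof. by move=> fG /fG. Qed.

Section Germs.
Context {R : realType} {P : topologicalType} {n : nat}.
Variable J : {set 'I_n}.
Local Notation X := (P * 'rV[R]_n)%type.
Implicit Types (f g : X -> R) (y z : X) (k : nat) (i : 'I_n).

Definition snbhs z : set_system X := within [set y | sector J y.2] (nbhs z).

Definition scont f y := f @ snbhs y --> f y.

Definition dquot f y i (h : R) : R := diff_quot (fun v => f (y.1, v)) y.2 i h.

Definition is_pder i f y (l : R) := dquot f y i @ increments (sector J) y.2 i --> l.

Definition pder i f y : R := partial (sector J) i (fun v => f (y.1, v)) y.2.

(* A germ at [z]: conditions are imposed at all points of [P * sector J] near [z], and
   derivatives are taken in the second variable only. *)
Fixpoint Ck k f z : Prop :=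
  if k is k'.+1 then
    (\forall y \near snbhs z, scont f y /\ forall i, is_pder i f y (pder i f y))
    /\ forall i, Ck k' (pder i f) z
  else \forall y \near snbhs z, scont f y.

Global Instance snbhs_filter z : Filter (snbhs z).
Proof. exact: within_filter. Qed.

Global Instance increments_filter (A : set 'rV[R]_n) v i : Filter (increments A v i).
Proof. exact: within_filter. Qed.

Lemma sector_shift (v : 'rV[R]_n) i (h : R) :
  sector J v -> 0 <= h -> sector J (v + h *: delta_mx 0 i).
Proof.
move=> Jv h0 j jJ; rewrite !mxE eqxx /=; apply: addr_ge0; first exact: Jv.
by case: (j == i); rewrite ?mulr1 ?mulr0.
Qed.

(** Positive increments never leave a sector, so the filter is proper and the limit that defines a
    one-sided derivative is unique. *)
Lemma increments_proper (v : 'rV[R]_n) i :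
  sector J v -> ProperFilter (increments (sector J) v i).
Proof.
move=> Jv; apply: Build_ProperFilter_ex => Q; rewrite /increments => wQ.
have /nbhs_ballP [e /= e0 eQ] : nbhs (0 : R)
  [set h | h != 0 -> sector J (v + h *: delta_mx 0 i) -> Q h].
  exact: wQ.
exists (e / 2); apply: eQ.
- rewrite /ball /= sub0r normrN gtr0_norm; first by rewrite gtr_pMr // invf_lt1 // ltr1n.
  by rewrite divr_gt0.
- by rewrite gt_eqF // divr_gt0.
- by apply: sector_shift => //; rewrite ltW // divr_gt0.
Qed.

Lemma snbhs_mem z (Q : set X) : sector J z.2 ->
  (\forall y \near snbhs z, Q y) -> Q z.
Proof. by move=> Jz /nbhs_singleton; apply. Qed.

(** Neighbourhoods may be taken open. Thus [Ck], a condition at all points near [z], can be checked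
    with equations that themselves hold only near [z]. *)
Lemma snbhs_near z (Q : set X) :
  (\forall y \near snbhs z, Q y) ->
  \forall y \near snbhs z, \forall y' \near snbhs y, Q y'.
Proof.
rewrite /snbhs /prop_near1 /within /= => /nbhs_interior.
by apply: filterS => y + _.
Qed.

Lemma snbhs_sector z : \forall y \near snbhs z, sector J y.2.
Proof. exact: withinT. Qed.

Lemma line_near (Q : set X) y i : (\forall y' \near snbhs y, Q y') ->
  \forall h \near increments (sector J) y.2 i, Q (y.1, y.2 + h *: delta_mx 0 i).
Proof.
move=> yQ; rewrite /increments !near_withinE.
have cl : (fun h : R => (y.1, y.2 + h *: delta_mx 0 i : 'rV[R]_n)) @ (0 : R) --> y.
  apply: cvg_to_pair => /=; first exact: cvg_cst.
  apply: cvg_rV => j; under eq_fun do rewrite !mxE.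
  set a : R := y.2 0 j; set b : R := ((0 == 0 :> 'I_1) && (j == i))%:R.
  have : a + h * b @[h --> (0 : R)] --> a + 0 * b.
    by apply: cvgD; [exact: cvg_cst|apply: cvgMr_tmp; exact: cvg_id].
  by rewrite mul0r addr0.
have := near_cvg cl yQ; apply: filterS => h hQ _ Jh; exact: hQ.
Qed.

End Germs.

Lemma cvg_eq_near {T U : Type} (F : set_system T) {FF : Filter F} (f g : T -> U)
    (G : set_system U) :
  (\forall t \near F, f t = g t) -> g @ F --> G -> f @ F --> G.
Proof.
move=> fg; apply: cvg_trans; apply: near_eq_cvg.
by apply: filterS fg => t ->.
Qed.

Section GermAlgebra.
Context {R : realType} {P : topologicalType} {n : nat}.
Variable J : {set 'I_n}.
Local Notation X := (P * 'rV[R]_n)%type.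
Implicit Types (f g : X -> R) (y z : X) (k : nat) (i : 'I_n).

Lemma scont_line f y i : scont J f y ->
  f (y.1, y.2 + h *: delta_mx 0 i) @[h --> increments (sector J) y.2 i] --> f y.
Proof. by move=> fy Q /fy; exact: line_near. Qed.

Lemma is_pder_unique f y i l : sector J y.2 -> is_pder J i f y l -> pder J i f y = l.
Proof.
move=> Jy; have := increments_proper i Jy => PF fl.
exact: (cvg_lim (@norm_hausdorff _ R) fl).
Qed.

Lemma pder_ex f y i l : sector J y.2 -> is_pder J i f y l -> is_pder J i f y (pder J i f y).
Proof. by move=> Jy fl; rewrite (is_pder_unique Jy fl). Qed.

Lemma eq_is_pder f g y i l : sector J y.2 ->
  (\forall y' \near snbhs J y, f y' = g y') -> is_pder J i f y l -> is_pder J i g y l.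
Proof.
move=> Jy fg; rewrite /is_pder => fl; apply: cvg_trans fl.
have fgy := snbhs_mem Jy fg.
apply: near_eq_cvg; have := line_near i fg; apply: filterS => h.
by rewrite /dquot /diff_quot -surjective_pairing fgy => ->.
Qed.

Lemma eq_pder f g y i : sector J y.2 ->
  (\forall y' \near snbhs J y, f y' = g y') -> pder J i f y = pder J i g y.
Proof.
move=> Jy fg; rewrite /pder /partial; congr (lim _).
have fgy := snbhs_mem Jy fg; have fgl := line_near i fg.
apply/seteqP; split; apply: near_eq_cvg; move: fgl; apply: filterS => h.
  by rewrite /diff_quot -surjective_pairing fgy => ->.
by rewrite /diff_quot -surjective_pairing fgy => ->.
Qed.

Lemma eq_scont f g y : sector J y.2 ->
  (\forall y' \near snbhs J y, f y' = g y') -> scont J f y -> scont J g y.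
Proof.
move=> Jy fg; rewrite /scont -(snbhs_mem Jy fg) => fy.
by apply: cvg_trans fy; exact: near_eq_cvg.
Qed.

Lemma eq_Ck k f g z : (\forall y \near snbhs J z, f y = g y) -> Ck J k f z -> Ck J k g z.
Proof.
elim: k f g z => [|k IH] f g z fg /=.
  apply: filterS3 (snbhs_near fg) (snbhs_sector J z) => y fgy Jy.
  exact: eq_scont.
move=> [fz fk]; split.
  apply: filterS3 (snbhs_near fg) (snbhs_sector J z) fz => y fgy Jy [fy fd].
  split; first exact: eq_scont fy.
  by move=> i; rewrite -(eq_pder i Jy fgy); exact: eq_is_pder (fd i).
move=> i; apply: IH (fk i); apply: filterS2 (snbhs_near fg) (snbhs_sector J z).
by move=> y fgy Jy; exact: eq_pder.
Qed.

Lemma Ck_scont k f z : Ck J k f z -> \forall y \near snbhs J z, scont J f y.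
Proof. by case: k => [//|k] /= [+ _]; apply: filterS => y []. Qed.

Lemma CkW k f z : Ck J k.+1 f z -> Ck J k f z.
Proof.
elim: k f => [|k IH] f.
  exact: Ck_scont.
move=> [fz fk]; split=> // i; exact: IH (fk i).
Qed.

(** Lets a proof exhibit the derivatives instead of computing [pder], which is a [lim]; on the
    sector, uniqueness of limits identifies the two. *)
Lemma CkS k f z (df : 'I_n -> X -> R) :
  (\forall y \near snbhs J z, scont J f y /\ forall i, is_pder J i f y (df i y)) ->
  (forall i, Ck J k (df i) z) -> Ck J k.+1 f z.
Proof.
move=> fz dfk; split.
  apply: filterS2 (snbhs_sector J z) fz => y Jy [fy fd]; split=> // i.
  exact: pder_ex (fd i).
move=> i; apply: eq_Ck (dfk i).
apply: filterS2 (snbhs_sector J z) fz => y Jy [fy fd].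
by rewrite (is_pder_unique Jy (fd i)).
Qed.

Lemma Ck_cst k (a : R) z : Ck J k (fun=> a) z.
Proof.
elim: k a => [|k IH] a; first by apply: nearW => y; exact: cvg_cst.
apply: (@CkS _ _ _ (fun _ _ => 0)); last by move=> i; exact: IH.
apply: nearW => y; split; first by apply: cvg_cst.
move=> i; rewrite /is_pder /dquot /diff_quot subrr.
by under eq_fun do rewrite mulr0; exact: cvg_cst.
Qed.

Lemma scontD f g y : scont J f y -> scont J g y -> scont J (fun y => f y + g y) y.
Proof. exact: cvgD. Qed.

Lemma scontM f g y : scont J f y -> scont J g y -> scont J (fun y => f y * g y) y.
Proof. exact: cvgM. Qed.

Lemma CkD k f g z : Ck J k f z -> Ck J k g z -> Ck J k (fun y => f y + g y) z.
Proof.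
elim: k f g => [|k IH] f g.
  by apply: filterS2 => y; exact: scontD.
move=> [fz fk] [gz gk].
apply: (@CkS _ _ _ (fun i y => pder J i f y + pder J i g y)); last first.
  by move=> i; exact: (IH _ _ (fk i) (gk i)).
apply: filterS2 fz gz => y [fy fd] [gy gd]; split; first exact: scontD.
move=> i; rewrite /is_pder; apply: cvg_trans (cvgD (fd i) (gd i)); apply: near_eq_cvg.
apply: nearW => h; rewrite fctE /dquot /diff_quot /=; ring.
Qed.

(** The derivative of a product contains [f] and [g] undifferentiated, so the induction step also
    uses them at the lower order, through [CkW]. *)
Lemma CkM k f g z : Ck J k f z -> Ck J k g z -> Ck J k (fun y => f y * g y) z.
Proof.
elim: k f g => [|k IH] f g.
  by apply: filterS2 => y; exact: scontM.
move=> fk1 gk1; have fk := CkW fk1; have gk := CkW gk1.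
have [fz dfk] := fk1; have [gz dgk] := gk1.
apply: (@CkS _ _ _ (fun i y => pder J i f y * g y + f y * pder J i g y)); last first.
  by move=> i; exact: (CkD (IH _ _ (dfk i) gk) (IH _ _ fk (dgk i))).
apply: filterS2 fz gz => y [fy fd] [gy gd]; split; first exact: scontM.
move=> i; rewrite /is_pder.
apply: cvg_trans (cvgD (cvgM (fd i) (scont_line i gy)) (cvgM (cvg_cst (f y)) (gd i))).
apply: near_eq_cvg.
apply: nearW => h; rewrite !fctE /dquot /diff_quot /= -!surjective_pairing; ring.
Qed.

Lemma Ck_sum k (I : Type) (r : seq I) (f : I -> X -> R) z :
  (forall j, Ck J k (f j) z) -> Ck J k (fun y => \sum_(j <- r) f j y) z.
Proof.
move=> fk; elim: r => [|j r IH].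
  by apply: eq_Ck (Ck_cst k 0 z); apply: nearW => y; rewrite big_nil.
by apply: eq_Ck (CkD (fk j) IH); apply: nearW => y; rewrite big_cons.
Qed.

(** The function is constant in the variable of differentiation, so all its derivatives vanish and
    only continuity in the parameter is at stake. *)
Lemma Ck_param k (u : P -> R) z : (\forall p \near z.1, {for p, continuous u}) ->
  Ck J k (fun y => u y.1) z.
Proof.
move=> uz.
have u0 : \forall y \near snbhs J z, scont J (fun y => u y.1) y.
  have : \forall y \near z, {for y.1, continuous u}.
    exact: (@near_cvg _ _ _ _ fst _ cvg_fst uz).
  move=> uz'; apply: (filterS _ (cvg_within _ uz')) => y uy.
  by apply: (@cvg_comp _ _ _ fst u _ _ _ _ uy); apply: cvg_within_filter; exact: cvg_fst.
case: k => [//|k].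
apply: (@CkS _ _ _ (fun _ _ => 0)); last by move=> i; exact: Ck_cst.
apply: filterS u0 => y uy; split=> // i.
rewrite /is_pder /dquot /diff_quot /= subrr.
by under eq_fun do rewrite mulr0; exact: cvg_cst.
Qed.

End GermAlgebra.

(** * The chain rule *)

Section MeanValue.
Context {R : realType} {P : topologicalType} {n : nat}.
Variables (J : {set 'I_n}) (G : P * 'rV[R]_n -> R) (p : P).
Implicit Types (v w : 'rV[R]_n) (i j : 'I_n).

Definition good v := scont J G (p, v) /\ forall i, is_pder J i G (p, v) (pder J i G (p, v)).

Lemma line_continuous (v : 'rV[R]_n) i : continuous (fun h : R => v + h *: delta_mx 0 i).
Proof.
move=> h; apply: cvg_rV => j; under eq_fun do rewrite !mxE.
rewrite !mxE; set b : R := (_ && _)%:R.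
by apply: cvgD; [exact: cvg_cst|apply: cvgMr_tmp; exact: cvg_id].
Qed.

Lemma mvt_line v j (t : R) : sector J v -> 0 < t ->
  (forall s, 0 <= s <= t -> good (v + s *: delta_mx 0 j)) ->
  exists2 s, 0 <= s <= t &
    G (p, v + t *: delta_mx 0 j) - G (p, v) = pder J j G (p, v + s *: delta_mx 0 j) * t.
Proof.
move=> Jv t0 H; pose g s := G (p, v + s *: delta_mx 0 j).
have dg s : s \in `]0, t[ -> is_derive s 1 g (pder J j G (p, v + s *: delta_mx 0 j)).
  rewrite in_itv /= => /andP[s0 st].
  have [_ /(_ j)] : good (v + s *: delta_mx 0 j) by apply: H; rewrite !ltW.
  rewrite /is_pder /= => gs.
  (* For [s > 0] every increment above [- s] stays in the sector, so at interior points of the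
     segment the derivative is two-sided and the usual mean value theorem applies. *)
  have nJ : \forall h \near (0 : R)^', sector J (v + s *: delta_mx 0 j + h *: delta_mx 0 j).
    have : \forall h \near (0 : R), - s < h.
      by apply: lt_nbhsr; rewrite oppr_lt0.
    move/(nbhs_dnbhs (x := (0 : R))); apply: filterS => h sh.
    rewrite -addrA -scalerDl; apply: sector_shift => //; lra.
  have gs' : h^-1 *: (g (h *: 1 + s) - g s) @[h --> (0 : R)^'] -->
     pder J j G (p, v + s *: delta_mx 0 j).
    move=> Q nQ; have wQ : \forall h \near (0 : R)^',
        sector J (v + s *: delta_mx 0 j + h *: delta_mx 0 j) ->
        Q (dquot G (p, v + s *: delta_mx 0 j) j h) by exact: (gs Q nQ).
    suff : \forall h \near (0 : R)^', Q (h^-1 *: (g (h *: 1 + s) - g s)) by [].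
    apply: filterS2 nJ wQ => h Jh /(_ Jh); rewrite /dquot /diff_quot /= /g.
    by rewrite -addrA -scalerDl [h *: 1]mulr1 (addrC s).
  apply: DeriveDef; first by apply/cvg_ex; exists (pder J j G (p, v + s *: delta_mx 0 j)).
  exact: (cvg_lim (@norm_hausdorff _ R) gs').
have cg : {within `[0, t], continuous g}.
  apply/subspace_continuousP => s; rewrite /= in_itv /= => st.
  have [gs _] := H _ st; move=> Q nQ.
  have Qs : \forall y \near (p, v + s *: delta_mx 0 j), sector J y.2 -> Q (G y) by exact: (gs Q nQ).
  have cl : (p, v + h *: delta_mx 0 j) @[h --> s] --> (p, v + s *: delta_mx 0 j).
    apply: cvg_to_pair.
      exact: cvg_cst.
    exact: line_continuous.
  suff : \forall h \near s, (h \in `[0, t]) -> Q (g h) by [].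
  have := near_cvg cl Qs; apply: filterS => h /= hQ /=; rewrite in_itv /= => /andP[h0 _].
  by apply: hQ; exact: sector_shift.
have [s st gE] := MVT_segment (ltW t0) dg cg.
exists s; first by move: st; rewrite in_itv.
by move: gE; rewrite /g scale0r addr0 subr0.
Qed.

(** The corners of a staircase from [v] to [w]. A sector constrains coordinates one at a time, so it
    contains every corner along with [v] and [w]. *)
Definition hybrid v w (k : nat) : 'rV[R]_n :=
  \row_(i < n) if (i < k)%N then w 0 i else v 0 i.

(** A coordinatewise bound, which forces intermediate points to converge to [v] when [w] does. *)
Definition between v w u :=
  sector J u /\ forall i, `|u 0 i - v 0 i| <= `|w 0 i - v 0 i|.

Lemma mvt_hybrid v w j : sector J v -> sector J w ->
  (forall u, between v w u -> good u) ->
  exists2 u, between v w u &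
    G (p, hybrid v w j.+1) - G (p, hybrid v w j) = pder J j G (p, u) * (w 0 j - v 0 j).
Proof.
move=> Jv Jw H.
have Jh k : sector J (hybrid v w k).
  by move=> i iJ; rewrite mxE; case: ifP => _; [exact: Jw|exact: Jv].
have hS : hybrid v w j.+1 = hybrid v w j + (w 0 j - v 0 j) *: delta_mx 0 j.
  apply/rowP => i; rewrite !mxE eqxx /= ltnS.
  case: (ltngtP i j) => [ij|ij|/val_inj ->].
  - by rewrite -val_eqE ltn_eqF //= mulr0 addr0.
  - by rewrite -val_eqE gtn_eqF //= mulr0 addr0.
  - by rewrite eqxx mulr1 addrC subrK.
have bt (s : R) : `|s| <= `|w 0 j - v 0 j| ->
    sector J (hybrid v w j + s *: delta_mx 0 j) ->
    between v w (hybrid v w j + s *: delta_mx 0 j).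
  move=> sw Js; split=> // i; rewrite !mxE eqxx /=.
  case: (ltngtP i j) => [ij|ij|/val_inj ->].
  - by rewrite -val_eqE ltn_eqF //= mulr0 addr0.
  - by rewrite -val_eqE gtn_eqF //= mulr0 addr0 subrr normr0.
  - by rewrite eqxx mulr1 addrAC subrr add0r.
have [d0|d0|d0] := ltgtP (w 0 j - v 0 j) 0.
(* A decreasing coordinate is treated by traversing the segment from its other end, because
   [mvt_line] only moves in the positive direction. *)
- have hS' : hybrid v w j = hybrid v w j.+1 + (v 0 j - w 0 j) *: delta_mx 0 j.
    by rewrite hS -addrA -scalerDl addrC [X in X *: _](_ : _ = 0) ?scale0r ?add0r //; ring.
  have bt' (s : R) : 0 <= s <= v 0 j - w 0 j ->
      between v w (hybrid v w j.+1 + s *: delta_mx 0 j).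
    move=> /andP[s0 sv].
    have := sector_shift j (Jh j.+1) s0; rewrite hS -addrA -scalerDl.
    by apply: bt; rewrite !ler0_norm; lra.
  have [||s sv E] := @mvt_line (hybrid v w j.+1) j (v 0 j - w 0 j) (Jh _).
  + lra.
  + by move=> s /bt' /H.
  exists (hybrid v w j.+1 + s *: delta_mx 0 j); first exact: bt'.
  by rewrite -hS' in E; rewrite -opprB E; ring.
- have bt' (s : R) : 0 <= s <= w 0 j - v 0 j ->
      between v w (hybrid v w j + s *: delta_mx 0 j).
    move=> /andP[s0 sv]; apply: bt; last exact: sector_shift.
    by rewrite !ger0_norm; lra.
  have [||s sv E] := @mvt_line (hybrid v w j) j (w 0 j - v 0 j) (Jh _).
  + lra.
  + by move=> s /bt' /H.
  by exists (hybrid v w j + s *: delta_mx 0 j); [exact: bt'|rewrite hS].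
- exists v; last by rewrite hS d0 scale0r addr0 mulr0 subrr.
  by split=> // i; rewrite subrr normr0.
Qed.

(** Telescoping over the staircase. Each coordinate has its own intermediate point, which does no
    harm where the partial derivatives are continuous. *)
Lemma mvt_sector v w : sector J v -> sector J w ->
  (forall u, between v w u -> good u) ->
  exists xi : 'I_n -> 'rV[R]_n, (forall j, between v w (xi j)) /\
    G (p, w) - G (p, v) = \sum_j pder J j G (p, xi j) * (w 0 j - v 0 j).
Proof.
move=> Jv Jw H.
have /choice [xi xiP] : forall j, exists u, between v w u /\
    G (p, hybrid v w j.+1) - G (p, hybrid v w j) = pder J j G (p, u) * (w 0 j - v 0 j).
  by move=> j; have [u ? ?] := mvt_hybrid j Jv Jw H; exists u.
exists xi; split; first by move=> j; case: (xiP j).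
under eq_bigr => j _ do rewrite -(proj2 (xiP j)).
rewrite -(big_mkord xpredT (fun k => G (p, hybrid v w k.+1) - G (p, hybrid v w k))).
rewrite telescope_sumr //; congr (G (p, _) - G (p, _)); apply/rowP => i; rewrite mxE.
  by rewrite ltn_ord.
by rewrite ltn0.
Qed.

End MeanValue.

Section ChainRule.
Context {R : realType} {P : topologicalType} {m n : nat}.
Variables (J : {set 'I_m}) (J' : {set 'I_n}).
Implicit Types (F : P * 'rV[R]_m -> 'rV[R]_n) (G : P * 'rV[R]_n -> R).

Lemma snbhs_box (p : P) (w : 'rV[R]_n) (Q : set (P * 'rV[R]_n)) :
  (\forall y \near snbhs J' (p, w), Q y) ->
  exists2 e : R, 0 < e & forall u, sector J' u ->
    (forall i, `|u 0 i - w 0 i| < e) -> Q (p, u).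
Proof.
move=> [[A B] /= [nA nB] AB].
have /nbhs_ballP [e /= e0 eB] := nB.
exists e => // u Ju uw; apply: (AB (p, u)) => //=; split; first exact: nbhs_singleton.
by apply: eB; split => // i j; rewrite (ord1 i) /ball /= distrC.
Qed.

Lemma graph_cvg F y : (forall j, scont J (fun y => F y 0 j) y) ->
  (\forall y' \near snbhs J y, sector J' (F y')) ->
  (y'.1, F y') @[y' --> snbhs J y] --> snbhs J' (y.1, F y).
Proof.
move=> Fy FJ.
have cF : (y'.1, F y') @[y' --> snbhs J y] --> (y.1, F y).
  apply: cvg_to_pair => /=; last exact: cvg_rV.
  by apply: cvg_within_filter; exact: cvg_fst.
move=> Q; rewrite /snbhs => nQ.
have {}nQ : \forall x \near (y.1, F y), sector J' x.2 -> Q x by exact: nQ.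
suff : \forall y' \near snbhs J y, Q (y'.1, F y') by [].
by apply: filterS2 FJ (near_cvg cF nQ) => y' Fy' /(_ Fy').
Qed.

(** By [mvt_sector] the difference quotient is a sum of partial derivatives of [G] at intermediate
    points times difference quotients of the coordinates of [F]. The intermediate points are
    squeezed towards [F y], and continuity of the partial derivatives gives the limit. *)
Lemma is_pder_comp F G y i (a : 'I_n -> R) : sector J y.2 ->
  (\forall y' \near snbhs J y, sector J' (F y')) ->
  (forall j, scont J (fun y => F y 0 j) y) ->
  (forall j, is_pder J i (fun y => F y 0 j) y (a j)) ->
  (\forall x \near snbhs J' (y.1, F y),
     scont J' G x /\ forall j, is_pder J' j G x (pder J' j G x)) ->
  (forall j, scont J' (pder J' j G) (y.1, F y)) ->
  is_pder J i (fun y => G (y.1, F y)) y (\sum_j pder J' j G (y.1, F y) * a j).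
Proof.
move=> Jy FJ Fy Fa Gy dGy.
pose W h := F (y.1, y.2 + h *: delta_mx 0 i).
have JFy := snbhs_mem Jy FJ.
have [e e0 eG] := snbhs_box Gy.
have nW (d : R) : 0 < d -> \forall h \near increments (sector J) y.2 i,
    forall j, `|W h 0 j - F y 0 j| < d.
  move=> d0; apply: filter_forall => j.
  have /cvg_ballP /(_ d d0) := scont_line i (Fy j).
  by apply: filterS => h; rewrite /ball /= distrC.
have JW : \forall h \near increments (sector J) y.2 i, sector J' (W h).
  exact: line_near FJ.
(* The intermediate points must become functions of [h] before a limit can be taken; where the mean
   value argument does not apply, the value [0] is a mere default. *)
have /choice [xi xiP] : forall h, exists xi : 'I_n -> 'rV[R]_n,
    sector J' (W h) -> (forall j, `|W h 0 j - F y 0 j| < e) ->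
    (forall j, between J' (F y) (W h) (xi j)) /\
    G (y.1, W h) - G (y.1, F y) = \sum_j pder J' j G (y.1, xi j) * (W h 0 j - F y 0 j).
  move=> h; have [JWh|] := pselect (sector J' (W h)); last by exists (fun=> 0).
  have [We|] := pselect (forall j, `|W h 0 j - F y 0 j| < e); last by exists (fun=> 0).
  have [|xi xiP] := @mvt_sector _ _ _ J' G y.1 (F y) (W h) JFy JWh.
    by move=> u [Ju uW]; apply: eG => // j; exact: le_lt_trans (uW j) (We j).
  by exists xi.
have xic j : pder J' j G (y.1, xi h j) @[h --> increments (sector J) y.2 i] -->
    pder J' j G (y.1, F y).
  move=> Q /dGy nQ; have {}nQ : \forall x \near snbhs J' (y.1, F y), Q (pder J' j G x) by exact: nQ.
  have [d d0 dQ] := snbhs_box nQ.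
  suff : \forall h \near increments (sector J) y.2 i, Q (pder J' j G (y.1, xi h j)) by [].
  apply: filterS3 JW (nW _ e0) (nW _ d0) => h Jh he hd.
  have [xb _] := xiP h Jh he; have [Jx xW] := xb j.
  by apply: dQ => // l; exact: le_lt_trans (xW l) (hd l).
rewrite /is_pder.
apply: (@cvg_eq_near _ _ _ _ _ (fun h => \sum_j pder J' j G (y.1, xi h j) *
  dquot (fun y => F y 0 j) y i h)).
  apply: filterS2 JW (nW _ e0) => h Jh he.
  have [_] := xiP h Jh he; rewrite /dquot /diff_quot /= -surjective_pairing => ->.
  by rewrite mulr_sumr; apply: eq_bigr => j _; rewrite /W; ring.
apply: cvg_big => //.
  by move=> x; apply: cvgD; [exact: cvg_fst|exact: cvg_snd].
by move=> j _; apply: cvgM; [exact: xic|exact: Fa].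
Qed.

(** Induction on the order for all [G] at once: a derivative of the composite is a sum of products,
    with one factor the composite of [pder J' j G] with [F], covered by the induction hypothesis,
    and the other a derivative of [F]. *)
Lemma Ck_comp k F G z : sector J z.2 ->
  (\forall y \near snbhs J z, sector J' (F y)) ->
  (forall j, Ck J k (fun y => F y 0 j) z) ->
  Ck J' k G (z.1, F z) -> Ck J k (fun y => G (y.1, F y)) z.
Proof.
move=> Jz FJ; elim: k G => [|k IH] G Fk Gk.
  have Fz : \forall y \near snbhs J z, forall j, scont J (fun y => F y 0 j) y.
    by apply: filter_forall => j; exact: Fk.
  have gc := graph_cvg (snbhs_mem Jz Fz) FJ.
  apply: filterS3 Fz (snbhs_near FJ) (near_cvg gc Gk) => y Fy FJy Gy.
  exact: (@cvg_comp _ _ _ _ _ _ _ _ (graph_cvg Fy FJy) Gy).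
have Fk' j := CkW (Fk j); have Gk' := CkW Gk.
have Fz : \forall y \near snbhs J z, forall j, scont J (fun y => F y 0 j) y.
  by apply: filter_forall => j; exact: Ck_scont (Fk j).
have Fd : \forall y \near snbhs J z, forall j,
   (forall i, is_pder J i (fun y => F y 0 j) y (pder J i (fun y => F y 0 j) y)).
  by apply: filter_forall => j; case: (Fk j) => + _; apply: filterS => y [].
have gc := graph_cvg (snbhs_mem Jz Fz) FJ.
have [Gd dGk] := Gk.
have dGc : \forall x \near snbhs J' (z.1, F z), forall j, scont J' (pder J' j G) x.
  by apply: filter_forall => j; exact: Ck_scont (dGk j).
apply: (@CkS _ _ _ _ _ _ _ (fun i y => \sum_j pder J' j G (y.1, F y) * pder J i (fun y => F y 0 j) y)).
  have Gn := near_cvg gc (snbhs_near Gd); have Gs := near_cvg gc dGc.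
  near=> y.
  have Jy : sector J y.2 by near: y; exact: snbhs_sector.
  have FJy : \forall y' \near snbhs J y, sector J' (F y') by near: y; exact: snbhs_near.
  have Fy : forall j, scont J (fun y => F y 0 j) y by near: y.
  have Fdy : forall j i, is_pder J i (fun y => F y 0 j) y (pder J i (fun y => F y 0 j) y).
    by near: y.
  have Gny : \forall x \near snbhs J' (y.1, F y),
    scont J' G x /\ forall j, is_pder J' j G x (pder J' j G x) by near: y.
  have Gsy : forall j, scont J' (pder J' j G) (y.1, F y) by near: y.
  split.
    have Gy : scont J' G (y.1, F y).
      by have [] := snbhs_mem (z := (y.1, F y)) (snbhs_mem Jy FJy) Gny.
    exact: (@cvg_comp _ _ _ _ _ _ _ _ (graph_cvg Fy FJy) Gy).
  by move=> i; apply: is_pder_comp.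
move=> i; apply: Ck_sum => j; apply: CkM; last first.
  by have [_ /(_ i)] := Fk j.
exact: (IH (pder J' j G) Fk' (dGk j)).
Unshelve. all: by end_near. Qed.

End ChainRule.

(** * Comparison with derivatives taken inside a relatively open set *)

Section Slices.
Context {R : realType} {P : topologicalType} {n : nat}.
Variable J : {set 'I_n}.
Implicit Types (y z : P * 'rV[R]_n).

Lemma snd_snbhs z : snd @ snbhs J z --> within (sector J) (nbhs z.2).
Proof.
move=> Q nQ; exists (setT, [set u | sector J u -> Q u]); first by split=> //; exact: filterT.
by move=> u [_ Qu]; exact: Qu.
Qed.

Lemma slice_snbhs (p : P) (v : 'rV[R]_n) :
  (fun u : 'rV[R]_n => (p, u)) @ within (sector J) (nbhs v) --> snbhs J (p, v).
Proof.
move=> Q [[A B] /= [nA nB] AB]; suff : nbhs v (fun u => sector J u -> Q (p, u)) by [].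
by apply: filterS nB => u Bu Ju; apply: (AB (p, u)) => //; split=> //; exact: nbhs_singleton.
Qed.

End Slices.

Section RelativelyOpen.
Context {R : realType} {n : nat}.
Variable J : {set 'I_n}.
Implicit Types (A : set 'rV[R]_n) (v : 'rV[R]_n) (w : seq 'I_n).

(** The shape of the domains of local representatives. At a point of [A] the small admissible
    increments are the same for [A] and for the sector, so both give the same derivatives. *)
Definition relopen (A : set 'rV[R]_n) := A `<=` sector J /\
  forall v, A v -> \forall u \near within (sector J) (nbhs v), A u.

Lemma slice_line (A : set 'rV[R]_n) v i : (\forall u \near within (sector J) (nbhs v), A u) ->
  \forall h \near increments (sector J) v i, A (v + h *: delta_mx 0 i).
Proof.
move=> nA; apply: (@line_near R 'rV[R]_n n J (fun y => A y.2) (v, v) i).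
exact: (near_cvg (@snd_snbhs R 'rV[R]_n n J (v, v)) nA).
Qed.

Lemma increments_local A v i : relopen A -> A v ->
  increments A v i = increments (sector J) v i.
Proof.
move=> [AJ Ao] Av; apply/seteqP; split => Q; rewrite /increments /within /= => HQ.
  have := slice_line i (Ao _ Av); rewrite /increments near_withinE /=.
  by move: HQ; apply: filterS2 => h QA hA Jh; apply: QA; exact: hA.
by move: HQ; apply: filterS => h hQ /AJ; exact: hQ.
Qed.

Lemma eq_partial_local A (f g : 'rV[R]_n -> R) v i : relopen A -> A v ->
  (forall u, A u -> f u = g u) -> partial A i f v = partial (sector J) i g v.
Proof.
move=> rA Av fg; rewrite /partial increments_local //; congr (lim _).
have nA := slice_line i (proj2 rA _ Av).
by apply/seteqP; split; apply: near_eq_cvg; apply: filterS nA => h Ah;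
  rewrite /diff_quot !fg.
Qed.

Lemma partials_local A w (f : 'rV[R]_n -> R) v : relopen A -> A v ->
  partials A w f v = partials (sector J) w f v.
Proof.
move=> rA; elim: w v => [//|i w IH] v Av /=; exact: eq_partial_local.
Qed.

End RelativelyOpen.

Section SmoothGerms.
Context {R : realType} {P : topologicalType} {n : nat}.
Variable J : {set 'I_n}.
Implicit Types (F : P * 'rV[R]_n -> R) (y z : P * 'rV[R]_n) (w : seq 'I_n).

Definition smooth_germ F z := forall k, Ck J k F z.

Definition pders w F := foldr (pder J) F w.

Lemma pdersE w F p v : pders w F (p, v) = partials (sector J) w (fun u => F (p, u)) v.
Proof.
elim: w v => [//|i w IH] v /=; rewrite /pder /=; congr (partial _ _ _ _).
by apply/funext => u; exact: IH.
Qed.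

Lemma Ck_words k F z :
  (forall w, \forall y \near snbhs J z, scont J (pders w F) y /\
    forall i, is_pder J i (pders w F) y (pder J i (pders w F) y)) -> Ck J k F z.
Proof.
elim: k F => [|k IH] F H; first by have := H [::]; apply: filterS => y [].
split; first exact: (H [::]).
(* [Ck] peels off the innermost derivative, which is the last letter of a word. *)
move=> i; apply: IH => w; have := H (rcons w i).
by rewrite /pders foldr_rcons.
Qed.

Lemma smooth_germ_pders w F z : smooth_germ F z -> smooth_germ (pders w F) z.
Proof.
elim: w => [//|i w IH] /IH Fz k; by have [_ /(_ i)] := Fz k.+1.
Qed.

Lemma smooth_germ_scont F z : sector J z.2 -> smooth_germ F z -> scont J F z.
Proof. by move=> Jz /(_ 0) /(snbhs_mem Jz). Qed.

Lemma smooth_germ_is_pder F z i : sector J z.2 -> smooth_germ F z -> is_pder J i F z (pder J i F z).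
Proof. by move=> Jz /(_ 1) [/(snbhs_mem Jz) [_ +] _]; exact. Qed.

Lemma pders_local A w F p v : relopen J A -> A v ->
  pders w F (p, v) = partials A w (fun u => F (p, u)) v.
Proof. by move=> rA Av; rewrite (partials_local _ _ rA Av) pdersE. Qed.

(** The passage from [Cinfty] to germs, with a map regarded as a family that is constant in the
    parameter; [smooth_germ_Cinfty] goes back, one slice at a time. *)
Lemma Cinfty_smooth_germ A (f : 'rV[R]_n -> R) z : relopen J A -> A z.2 -> Cinfty A f ->
  smooth_germ (fun y => f y.2) z.
Proof.
move=> rA Az fA k; apply: Ck_words => w.
have [cw dw] := fA w.
have nA : \forall y \near snbhs J z, A y.2 := near_cvg (@snd_snbhs _ _ _ J z) (proj2 rA _ Az).
have pE y : A y.2 -> partials A w f y.2 = pders w (fun y => f y.2) y.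
  by move=> Ay; rewrite [y in RHS]surjective_pairing (pders_local w (fun y => f y.2) y.1 rA Ay).
apply: filterS3 nA (snbhs_near nA) (snbhs_sector J z) => y Ay nAy Jy.
have {}nAy : \forall y' \near snbhs J y, partials A w f y'.2 = pders w (fun y => f y.2) y'.
  by apply: filterS nAy => y' /pE.
split.
  apply: (eq_scont Jy nAy); move/subspace_continuousP : cw => /(_ _ Ay) cw Q /cw nQ.
  have {}nQ : nbhs y.2 (fun u => A u -> Q (partials A w f u)) by [].
  have {}nQ : \forall u \near within (sector J) (nbhs y.2), Q (partials A w f u).
    have nAy2 := proj2 rA _ Ay; rewrite near_withinE in nAy2.
    by rewrite near_withinE; move: nAy2 nQ; apply: filterS2 => u Au Qu /Au.
  exact: (near_cvg (@snd_snbhs _ _ _ J y) nQ).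
move=> i; apply: pder_ex => //; apply: (eq_is_pder Jy nAy); rewrite /is_pder.
by rewrite -(increments_local i rA Ay); exact: dw.
Qed.

Lemma smooth_germ_Cinfty A F p : relopen J A -> (forall v, A v -> smooth_germ F (p, v)) ->
  Cinfty A (fun v => F (p, v)).
Proof.
move=> rA FA w; split.
  apply/subspace_continuousP => v Av.
  have Jv : sector J v := proj1 rA _ Av.
  have Fw : scont J (pders w F) (p, v) := @smooth_germ_scont _ (p, v) Jv (smooth_germ_pders w (FA v Av)).
  rewrite /from_subspace -(pders_local w F p rA Av) => Q /Fw nQ.
  have {}nQ := near_cvg (@slice_snbhs _ _ _ J p v) nQ.
  have {}nQ : nbhs v (fun u => sector J u -> Q (pders w F (p, u))) := nQ.
  suff : nbhs v (fun u => A u -> Q (partials A w (fun v => F (p, v)) u)) by [].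
  by apply: filterS nQ => u Qu Au; rewrite -(pders_local w F p rA Au); exact/Qu/(proj1 rA).
move=> i v Av; have Jv : sector J v := proj1 rA _ Av.
rewrite (increments_local i rA Av).
have := @smooth_germ_is_pder _ (p, v) i Jv (smooth_germ_pders w (FA v Av)); rewrite /is_pder /= => H.
apply/cvg_ex; eexists; apply: cvg_eq_near H.
have nA := slice_line i (proj2 rA _ Av); apply: filterS nA => h Ah.
by rewrite /dquot /diff_quot /= -!(pders_local w F p rA).
Qed.

Lemma eq_smooth_germ F G z : (\forall y \near snbhs J z, F y = G y) -> smooth_germ F z -> smooth_germ G z.
Proof. by move=> FG Fz k; exact: eq_Ck (Fz k). Qed.

Lemma smooth_germ_cst (a : R) z : smooth_germ (fun=> a) z.
Proof. by move=> k; exact: Ck_cst. Qed.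

Lemma smooth_germD F G z : smooth_germ F z -> smooth_germ G z -> smooth_germ (fun y => F y + G y) z.
Proof. by move=> Fz Gz k; exact: CkD. Qed.

Lemma smooth_germM F G z : smooth_germ F z -> smooth_germ G z -> smooth_germ (fun y => F y * G y) z.
Proof. by move=> Fz Gz k; exact: CkM. Qed.

Lemma smooth_germ_sum (I : Type) (r : seq I) (F : I -> P * 'rV[R]_n -> R) z :
  (forall j, smooth_germ (F j) z) -> smooth_germ (fun y => \sum_(j <- r) F j y) z.
Proof. by move=> Fz k; apply: Ck_sum => j; exact: Fz. Qed.

End SmoothGerms.

Lemma smooth_germ_comp {R : realType} {P : topologicalType} {m n : nat} (J : {set 'I_m})
    (J' : {set 'I_n}) (F : P * 'rV[R]_m -> 'rV[R]_n) (G : P * 'rV[R]_n -> R) z :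
  sector J z.2 -> (\forall y \near snbhs J z, sector J' (F y)) ->
  (forall j, smooth_germ J (fun y => F y 0 j) z) -> smooth_germ J' G (z.1, F z) ->
  smooth_germ J (fun y => G (y.1, F y)) z.
Proof. by move=> Jz FJ Fz Gz k; apply: (Ck_comp Jz FJ) => // j; exact: Fz. Qed.

(** * A flat function *)

Section SmoothReal.
Context {R : realType} {P : topologicalType}.
Implicit Types (g : R -> R).
Local Notation J0 := (finset.set0 : {set 'I_1}).

(** Functions of one real variable enter as functions on row vectors of length one with no
    constrained coordinate, so that the chain rule applies to them. *)
Definition Ck1 k g := forall z : P * 'rV[R]_1, Ck J0 k (fun y => g (y.2 0 0)) z.

Lemma is_derive_pder g (l : R) (y : P * 'rV[R]_1) i : is_derive (y.2 0 0) 1 g l ->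
  is_pder J0 i (fun y => g (y.2 0 0)) y l.
Proof.
move=> [gd gl]; have gc : h^-1 *: ((g \o shift (y.2 0 0)) (h *: 1) - g (y.2 0 0))
    @[h --> (0 : R)^'] --> l by rewrite -gl; exact: gd.
rewrite /is_pder.
apply: (@cvg_eq_near _ _ _ _ _
  (fun h : R => h^-1 *: ((g \o shift (y.2 0 0)) (h *: 1) - g (y.2 0 0)))).
  apply: nearW => h; rewrite /dquot /diff_quot /= !mxE (ord1 i) !eqxx /= mulr1.
  by rewrite [h *: 1]mulr1 (addrC h).
exact: cvg_within_filter.
Qed.

Lemma Ck1_S k g g' : (forall x : R, is_derive x 1 g (g' x)) -> Ck1 k g' -> Ck1 k.+1 g.
Proof.
move=> gd g'k z; apply: (@CkS _ _ _ _ _ _ _ (fun _ y => g' (y.2 0 0))).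
  apply: nearW => y; split.
    have gc : g @ (y.2 0 0) --> g (y.2 0 0).
      by apply/differentiable_continuous/derivable1_diffP; case: (gd (y.2 0 0)).
    apply: (@cvg_comp _ _ _ (fun y : P * 'rV[R]_1 => y.2 0 0) g _ _ _ _ gc).
    apply: cvg_coord; apply: cvg_within_filter; exact: cvg_snd.
  by move=> i; exact: is_derive_pder.
by move=> i; exact: g'k.
Qed.

Lemma Ck1_lin k g h (a : R) : Ck1 k g -> Ck1 k h -> Ck1 k (fun x => a * g x + h x).
Proof.
move=> gk hk z; apply: CkD; last exact: hk.
by apply: CkM; [exact: Ck_cst|exact: gk].
Qed.

(** The powers of [x^-1] are carried along because every derivative of [flat 0] is a linear
    combination of such functions. *)
Definition flat m (x : R) : R := if 0 < x then x^-1 ^+ m * expR (- x^-1) else 0.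

Lemma flat_ge0 m x : 0 <= flat m x.
Proof.
by rewrite /flat; case: ifP => // x0; rewrite mulr_ge0 ?expR_ge0// exprn_ge0 // invr_ge0 ltW.
Qed.

(** With [t = x^-1] this is the bound of [expR t] from below by one term of its series,
    [t ^ (m+1) / (m+1)!]. *)
Lemma flat_le m x : 0 <= x -> flat m x <= (m.+1)`!%:R * x.
Proof.
rewrite /flat le_eqVlt => /predU1P[<-|x0]; first by rewrite ltxx mulr0.
rewrite x0 expRN ler_pdivrMr ?expR_gt0 //.
have t0 : 0 <= x^-1 by rewrite invr_ge0 ltW.
have := expR_ge1Dxn m t0; rewrite -lerBrDl => H.
have {}H : x^-1 ^+ m.+1 / (m.+1)`!%:R <= expR x^-1 by apply: le_trans H _; rewrite gerBl.
move: H; rewrite ler_pdivrMr ?ltr0n ?fact_gt0 // exprS => H.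
rewrite -(ler_pM2l (x := x^-1)) ?invr_gt0 //.
apply: le_trans H _; rewrite le_eqVlt; apply/orP; left; apply/eqP.
by field; rewrite gt_eqF.
Qed.

Lemma flat_derive m (x : R) : is_derive x 1 (flat m) (- m%:R * flat m.+1 x + flat m.+2 x).
Proof.
have [x0|x0|->] := ltgtP x 0.
- have -> : - m%:R * flat m.+1 x + flat m.+2 x = 0.
    by rewrite /flat ltNge (ltW x0) /= mulr0 addr0.
  apply: (@near_eq_is_derive _ _ _ (cst (0 : R))).
  have := lt_nbhsl x0; apply: filterS => y y0.
  by rewrite /flat ltNge (ltW y0).
- have xn0 : x != 0 by rewrite gt_eqF.
  pose g (y : R) := y^-1 ^+ m * expR (- y^-1).
  apply: (@near_eq_is_derive _ _ _ g).
    have := lt_nbhsr x0; apply: filterS => y y0.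
    by rewrite /flat y0.
  have iV : is_derive x 1 (fun y : R => y^-1) (- x ^- 2).
    have := @is_deriveV R id x 1 1 xn0 (is_derive_id _ _).
    by rewrite /= [_ *: 1]mulr1.
  have iX : is_derive x 1 (fun y : R => y^-1 ^+ m) (m%:R * x^-1 ^+ m.-1 * - x ^- 2).
    have := @is_deriveX R R (fun y : R => y^-1) m x 1 (- x ^- 2) iV.
    by rewrite exprfctE.
  have iE : is_derive x 1 (fun y : R => expR (- y^-1)) (expR (- x^-1) * x ^- 2).
    have iN : is_derive x 1 (fun y : R => - y^-1) (x ^- 2).
      by rewrite -[x ^- 2]opprK; exact: is_deriveN.
    exact: (@is_derive1_comp _ expR (fun y : R => - y^-1)).
  apply: (@is_derive_eq _ _ _ _ _ _ _ _ (@is_deriveM R R _ _ x 1 _ _ iX iE)).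
  rewrite /flat x0 -!exprVn -![_ *: _]/(_ * _) !exprS.
  clear iX g; case: m => [|m]; first by rewrite !mul0r /=; ring.
  by rewrite /= exprS; ring.
- have -> : - m%:R * flat m.+1 0 + flat m.+2 0 = 0 by rewrite /flat ltxx mulr0 addr0.
  have d0 : h^-1 *: ((flat m \o shift 0) (h *: 1) - flat m 0) @[h --> (0 : R)^'] --> (0 : R).
    apply/norm_cvg0P.
    (* For [h > 0] the difference quotient of [flat m] at [0] is [flat m.+1 h]; the factorial is the
       constant of [flat_le] for that function. *)
    pose C : R := (m.+2)`!%:R.
    apply: (@squeeze_cvgr _ _ _ _ (cst 0) (fun h => C * `|h|)).
    + apply: (filterS _ (@nbhs_dnbhs_neq _ (0 : R))) => h h0.
      rewrite normr_ge0 /= addr0 [h *: 1]mulr1 [flat m 0]/flat ltxx subr0 -[_ *: _]/(_ * _).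
      have [hp|hn] := ltP 0 h; last first.
        have -> : flat m h = 0 by rewrite /flat ltNge hn.
        by rewrite [h^-1 * 0]mulr0 normr0 mulr_ge0 // ler0n.
      have -> : h^-1 * flat m h = flat m.+1 h by rewrite /flat hp exprS mulrA.
      by rewrite (ger0_norm (flat_ge0 _ _)) (gtr0_norm hp); exact: (flat_le m.+1 (ltW hp)).
    + exact: cvg_cst.
    + have : C * `|h| @[h --> (0 : R)] --> C * `|0 : R|.
        by apply: cvgM; [exact: cvg_cst|exact: norm_continuous].
      by rewrite normr0 mulr0 => H; apply: cvg_within_filter.
  apply: DeriveDef; first by apply/cvg_ex; exists 0.
  exact: (cvg_lim (@norm_hausdorff _ R) d0).
Qed.

Lemma Ck1_flat k m : Ck1 k (flat m).
Proof.
elim: k m => [|k IH] m; last first.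
  by apply: (Ck1_S (flat_derive m)); apply: Ck1_lin; exact: IH.
move=> z; apply: nearW => y.
have gc : flat m @ (y.2 0 0) --> flat m (y.2 0 0).
  by apply/differentiable_continuous/derivable1_diffP; case: (flat_derive m (y.2 0 0)).
apply: (@cvg_comp _ _ _ (fun y : P * 'rV[R]_1 => y.2 0 0) (flat m) _ _ _ _ gc).
apply: cvg_coord; apply: cvg_within_filter; exact: cvg_snd.
Qed.

Lemma smooth_germ_flat n (J : {set 'I_n}) (F : P * 'rV[R]_n -> R) z : sector J z.2 ->
  smooth_germ J F z -> smooth_germ J (fun y => flat 0 (F y)) z.
Proof.
move=> Jz Fz.
have := @smooth_germ_comp R P n 1 J J0 (fun y => const_mx (F y)) (fun y => flat 0 (y.2 0 0)) z Jz.
move=> H; apply: eq_smooth_germ (H _ _ _).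
- by apply: nearW => y /=; rewrite mxE.
- by apply: nearW => y i; rewrite inE.
- by move=> j; apply: eq_smooth_germ Fz; apply: nearW => y; rewrite mxE.
- by move=> k; exact: Ck1_flat.
Qed.

End SmoothReal.

(** * Smooth families of maps between manifolds *)

Lemma near_snd {P M : topologicalType} (z : P * M) (Q : set M) :
  (\forall x \near z.2, Q x) -> \forall y \near z, Q y.2.
Proof. by move=> Qz; exact: (near_cvg (f := snd) cvg_snd Qz). Qed.

Section Charts.
Context {R : realType} {M : topologicalType} {m : nat}.
Implicit Types (c : chart R M m) (x : M) (v : 'rV[R]_m).

Definition sectn c v : set_system 'rV[R]_m := within (sector (cset c)) (nbhs v).

Global Instance sectn_filter c v : Filter (sectn c v).
Proof. exact: within_filter. Qed.

(** A pointwise form of [is_chart] in terms of filters: relative openness of the image becomes the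
    fact that [cinv c] inverts [cfun c] on the sector near [cfun c x]. *)
Definition chart_ok c := forall x, cdom c x ->
  [/\ \forall y \near x, cdom c y,
      cinv c (cfun c x) = x,
      cfun c @ x --> sectn c (cfun c x),
      \forall v \near sectn c (cfun c x), cdom c (cinv c v) /\ cfun c (cinv c v) = v &
      cinv c @ sectn c (cfun c x) --> x].

Lemma is_chart_ok c : is_chart c -> chart_ok c.
Proof.
move=> [cO [V oV cV] cK cc ci] x cx.
have near_cdom : \forall y \near x, cdom c y by exact: open_nbhs_nbhs.
have Vcx : (V `&` sector (cset c)) (cfun c x) by rewrite -cV; exists x.
have imc : \forall v \near sectn c (cfun c x), (cfun c @` cdom c) v.
  rewrite cV /sectn near_withinE.
  have : \forall v \near cfun c x, V v by apply: open_nbhs_nbhs; split=> //; case: Vcx.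
  by apply: filterS.
split=> //.
- exact: cK.
- move/subspace_continuousP : cc => /(_ _ cx) cc Q.
  rewrite /sectn => nQ; have {}nQ : nbhs (cfun c x) (fun v => sector (cset c) v -> Q v) := nQ.
  have {}nQ : nbhs x (fun y => cdom c y -> sector (cset c) (cfun c y) -> Q (cfun c y)) := cc _ nQ.
  suff : nbhs x (fun y => Q (cfun c y)) by [].
  apply: filterS2 near_cdom nQ => y cy /(_ cy); apply.
  have : (cfun c @` cdom c) (cfun c y) by exists y.
  by rewrite cV => -[].
- by apply: filterS imc => _ [y cy <-]; rewrite cK.
- have ix : (cfun c @` cdom c) (cfun c x) by exists x.
  move/subspace_continuousP : ci => /(_ _ ix) ci Q nQ.
  rewrite -[in nbhs _](cK _ cx) in nQ.
  have {}nQ : nbhs (cfun c x) (fun v => (cfun c @` cdom c) v -> Q (cinv c v)) := ci _ nQ.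
  suff : nbhs (cfun c x) (fun v => sector (cset c) v -> Q (cinv c v)) by [].
  have {}imc : nbhs (cfun c x) (fun v => sector (cset c) v -> (cfun c @` cdom c) v) := imc.
  by apply: filterS2 imc nQ => v iv Qv Jv; exact/Qv/iv.
Qed.

Lemma chart_sector c x : chart_ok c -> cdom c x -> sector (cset c) (cfun c x).
Proof.
move=> cok cx; have [_ _ cc _ _] := cok x cx.
have : \forall v \near sectn c (cfun c x), sector (cset c) v by exact: withinT.
by move=> /(near_cvg cc) /nbhs_singleton.
Qed.

Definition atlas_ok (A : atlas R M m) :=
  A `<=` chart_ok /\ forall x, exists2 c, A c & cdom c x.

Lemma manifold_atlas_ok (A : atlas R M m) : manifold_with_corners A -> atlas_ok A.
Proof.
move=> [_ _ AC Acov _]; split; first by move=> c /AC /is_chart_ok.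
by move=> x; have : [set: M] x by []; rewrite -Acov => -[c Ac cx]; exists c.
Qed.

End Charts.

Section ParametrizedCharts.
Context {R : realType} {P M : topologicalType} {m : nat}.
Implicit Types (c : chart R M m) (z : P * M) (u : P * M -> R) (p : P) (x : M).

Lemma fst_snbhs n (J : {set 'I_n}) (y : P * 'rV[R]_n) : fst @ snbhs J y --> y.1.
Proof. by apply: cvg_within_filter; exact: cvg_fst. Qed.

Lemma cinv_pair_cvg c p x : chart_ok c -> cdom c x ->
  (fun y => (y.1, cinv c y.2)) @ snbhs (cset c) (p, cfun c x) --> (p, x).
Proof.
move=> cok cx; have [_ _ _ _ ci] := cok x cx.
have sn : snd @ snbhs (cset c) (p, cfun c x) --> sectn c (cfun c x) := @snd_snbhs _ _ _ _ _.
apply: cvg_to_pair => /=; first exact: (@fst_snbhs _ (cset c) (p, cfun c x)).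
exact: (cvg_comp _ _ sn ci).
Qed.

Lemma cfun_pair_cvg c p x : chart_ok c -> cdom c x ->
  (fun y => (y.1, cfun c y.2)) @ (p, x) --> snbhs (cset c) (p, cfun c x).
Proof.
move=> cok cx; have [_ _ cc _ _] := cok x cx.
move=> Q [[A B] /= [nA nB] AB].
have {}nB : sectn c (cfun c x) B by exact: (@cvg_within _ _ (nbhs_filter (cfun c x)) (sector (cset c)) B nB).
have nB1 := near_cvg cc nB.
have nJ := near_cvg cc (withinT (sector (cset c)) (nbhs_filter (cfun c x))).
suff : nbhs (p, x) (fun y => Q (y.1, cfun c y.2)) by [].
exists (A, [set y | B (cfun c y) /\ sector (cset c) (cfun c y)]).
  by split=> //=; exact: filterI.
by move=> [q y] /= [Aq [By Jy]]; apply: (AB (q, cfun c y)).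
Qed.

Lemma cfun_cinv_near c p x : chart_ok c -> cdom c x ->
  \forall y \near snbhs (cset c) (p, cfun c x),
    cdom c (cinv c y.2) /\ cfun c (cinv c y.2) = y.2.
Proof.
move=> cok cx; have [_ _ _ ci _] := cok x cx.
have sn : snd @ snbhs (cset c) (p, cfun c x) --> sectn c (cfun c x) := @snd_snbhs _ _ _ _ _.
exact: (near_cvg sn ci).
Qed.

Definition chart_smooth c u z := smooth_germ (cset c) (fun y => u (y.1, cinv c y.2)) (z.1, cfun c z.2).

Definition smooth_fun (A : atlas R M m) u z := forall c, A c -> cdom c z.2 -> chart_smooth c u z.

Lemma eq_chart_smooth c u u' z : chart_ok c -> cdom c z.2 ->
  (\forall y \near z, u y = u' y) -> chart_smooth c u z -> chart_smooth c u' z.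
Proof.
move=> cok cz uu'; apply: eq_smooth_germ.
have cv := cinv_pair_cvg (p := z.1) cok cz; rewrite -surjective_pairing in cv.
exact: (near_cvg cv uu').
Qed.

Lemma chart_smooth_fst c (v : P -> R) z : (\forall p \near z.1, {for p, continuous v}) ->
  chart_smooth c (fun y => v y.1) z.
Proof. by move=> vz k; exact: Ck_param. Qed.

Variables (A : atlas R M m) (Aok : atlas_ok A).

Lemma eq_smooth_fun u u' z : (\forall y \near z, u y = u' y) -> smooth_fun A u z -> smooth_fun A u' z.
Proof. by move=> uu' uz c Ac cz; apply: eq_chart_smooth (uz c Ac cz) => //; exact: (proj1 Aok). Qed.

Lemma smooth_fun_cst (a : R) z : smooth_fun A (fun=> a) z.
Proof. by move=> c _ _; exact: smooth_germ_cst. Qed.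

Lemma smooth_funD u u' z : smooth_fun A u z -> smooth_fun A u' z -> smooth_fun A (fun y => u y + u' y) z.
Proof. by move=> uz uz' c Ac cz; apply: smooth_germD; [exact: uz|exact: uz']. Qed.

Lemma smooth_funM u u' z : smooth_fun A u z -> smooth_fun A u' z -> smooth_fun A (fun y => u y * u' y) z.
Proof. by move=> uz uz' c Ac cz; apply: smooth_germM; [exact: uz|exact: uz']. Qed.

Lemma smooth_funB u u' z : smooth_fun A u z -> smooth_fun A u' z -> smooth_fun A (fun y => u y - u' y) z.
Proof.
move=> uz uz'; rewrite (_ : (fun y => u y - u' y) = fun y => u y + -1 * u' y).
  by apply: smooth_funD => //; apply: smooth_funM => //; exact: smooth_fun_cst.
by apply/funext => y; rewrite mulN1r.
Qed.

Lemma smooth_fun_sum (I : Type) (r : seq I) (u : I -> P * M -> R) z :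
  (forall j, smooth_fun A (u j) z) -> smooth_fun A (fun y => \sum_(j <- r) u j y) z.
Proof. by move=> uz c Ac cz; apply: smooth_germ_sum => j; exact: uz. Qed.

Lemma smooth_fun_flat u z : smooth_fun A u z -> smooth_fun A (fun y => flat 0 (u y)) z.
Proof.
move=> uz c Ac cz; apply: (@smooth_germ_flat _ _ _ _ (fun y => u (y.1, cinv c y.2))).
  exact: chart_sector (proj1 Aok _ Ac) cz.
exact: uz.
Qed.

End ParametrizedCharts.

Section SmoothFamilies.
Context {R : realType} {P : topologicalType}.

(** Joint continuity keeps nearby values in the domain of the chart [d], where [cfun d] is
    meaningful; the second clause then speaks about a genuine local representative. *)
Definition smooth_family {M N : topologicalType} {m n : nat} (AM : atlas R M m) (AN : atlas R N n)
    (F : P * M -> N) (z : P * M) :=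
  F @ z --> F z /\
  forall d j, AN d -> cdom d (F z) -> smooth_fun AM (fun y => cfun d (F y) 0 j) z.

Context {M N Q : topologicalType} {m n q : nat}.
Variables (AM : atlas R M m) (AN : atlas R N n) (AQ : atlas R Q q).
Hypotheses (okM : atlas_ok AM) (okN : atlas_ok AN) (okQ : atlas_ok AQ).
Implicit Types (F : P * M -> N) (z : P * M).

Lemma eq_smooth_family F F' z : (\forall y \near z, F y = F' y) ->
  smooth_family AM AN F z -> smooth_family AM AN F' z.
Proof.
move=> FF' [Fc Fz]; have Fzz := nbhs_singleton FF'; split.
  rewrite -Fzz; apply: cvg_eq_near Fc.
  by apply: filterS FF' => y ->.
move=> d j Ad; rewrite -Fzz => dz; apply: (eq_smooth_fun okM) (Fz d j Ad dz).
by apply: filterS FF' => y ->.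
Qed.

Lemma smooth_family_dom F z d :
  AN d -> cdom d (F z) -> smooth_family AM AN F z -> \forall y \near z, cdom d (F y).
Proof.
move=> Ad dz [Fc _]; have [dn _ _ _ _] := proj1 okN _ Ad _ dz.
exact: (near_cvg Fc dn).
Qed.

(** The value is routed through a chart of [N] around [F z]; what remains is the chain rule for
    local representatives, with the parameter passed along unchanged. *)
Lemma smooth_fun_comp F (u : P * N -> R) z : smooth_family AM AN F z -> smooth_fun AN u (z.1, F z) ->
  smooth_fun AM (fun y => u (y.1, F y)) z.
Proof.
move=> Fz uz c Ac cz; have cok := proj1 okM _ Ac.
have [d Ad dz] := proj2 okN (F z); have dok := proj1 okN _ Ad.
have [_ dK _ _ _] := dok _ dz.
have Fd := smooth_family_dom Ad dz Fz.
apply: (@eq_chart_smooth _ _ _ _ _ (fun y => u (y.1, cinv d (cfun d (F y))))) => //.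
  by apply: filterS Fd => y dy; have [_ -> _ _ _] := dok _ dy.
pose F' (y : P * 'rV[R]_m) := cfun d (F (y.1, cinv c y.2)).
have [_ cK _ _ _] := cok _ cz.
have zE : (z.1, cinv c (cfun c z.2)) = z by rewrite cK -surjective_pairing.
apply: (@smooth_germ_comp _ _ _ _ _ (cset d) F' (fun y => u (y.1, cinv d y.2))).
- exact: chart_sector.
- have cv := cinv_pair_cvg (p := z.1) cok cz.
  rewrite -surjective_pairing in cv.
  by have := near_cvg cv Fd; apply: filterS => y dy; exact: chart_sector.
- by move=> j; exact: (proj2 Fz d j Ad dz c Ac cz).
- by rewrite /F' /= zE; exact: (uz d Ad dz).
Qed.

Lemma smooth_family_comp F (G : P * N -> Q) z : smooth_family AM AN F z -> smooth_family AN AQ G (z.1, F z) ->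
  smooth_family AM AQ (fun y => G (y.1, F y)) z.
Proof.
move=> Fz [Gc Gz]; split.
  apply: (@cvg_comp _ _ _ (fun y => (y.1, F y)) G _ _ _ _ Gc).
  by apply: cvg_to_pair => /=; [exact: cvg_fst|case: Fz].
by move=> d j Ad dG; apply: (@smooth_fun_comp F (fun y => cfun d (G y) 0 j)) => //; exact: Gz.
Qed.

End SmoothFamilies.

Section RepresentativeDomains.
Context {R : realType} {M N : topologicalType} {m n : nat}.
Implicit Types (W : set M) (f : M -> N) (c : chart R M m) (d : chart R N n).

Lemma within_open_cvg W f x : open W -> {within W, continuous f} -> W x -> f @ x --> f x.
Proof.
move=> oW /subspace_continuousP fc Wx Q nQ.
have {}nQ : nbhs x (fun y => W y -> Q (f y)) := fc x Wx _ nQ.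
suff : nbhs x (fun y => Q (f y)) by [].
by have : nbhs x W by [exact: open_nbhs_nbhs]; move: nQ; apply: filterS2 => y Qy /Qy.
Qed.

Lemma rep_dom_relopen W f c d : open W -> (forall x, W x -> f @ x --> f x) ->
  chart_ok c -> chart_ok d -> relopen (cset c) (rep_dom c d W f).
Proof.
move=> oW fc cok dok; split; first by move=> _ [x [[_ cx] _] <-]; exact: chart_sector.
move=> _ [x [[Wx cx] dx] <-]; have [_ _ _ ci cic] := cok _ cx; have [dn _ _ _ _] := dok _ dx.
have nW : \forall y \near x, W y by exact: open_nbhs_nbhs.
apply: filterS3 ci (near_cvg cic nW) (near_cvg cic (near_cvg (fc _ Wx) dn)) => v [cv vK] Wv dv.
by exists (cinv c v).
Qed.

End RepresentativeDomains.

Section SmoothMapsAsFamilies.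
Context {R : realType} {M N : topologicalType} {m n : nat}.
Variables (AM : atlas R M m) (AN : atlas R N n).
Hypotheses (okM : atlas_ok AM) (okN : atlas_ok AN).
Implicit Types (W : set M) (f : M -> N) (c : chart R M m) (d : chart R N n).

Lemma family_of_smooth {P : topologicalType} W f (z : P * M) : open W -> W z.2 ->
  smooth_on AM AN W f -> smooth_family AM AN (fun y => f y.2) z.
Proof.
move=> oW Wz [fc fC].
have {}fc x (Wx : W x) := within_open_cvg oW fc Wx.
split.
  by apply: (@cvg_comp _ _ _ snd f _ _ _ _ (fc _ Wz)); exact: cvg_snd.
move=> d j Ad dz c Ac cz; apply: (@Cinfty_smooth_germ _ _ _ _ (rep_dom c d W f) (rep c d f j)) => /=.
- by apply: rep_dom_relopen => //; [exact: (proj1 okM)|exact: (proj1 okN)].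
- by exists z.2.
- exact: fC.
Qed.

Lemma smooth_of_family {P : topologicalType} (F : P * M -> N) (p : P) :
  (forall x, smooth_family AM AN F (p, x)) -> smooth_on AM AN [set: M] (fun x => F (p, x)).
Proof.
move=> Fp; have Fc x : F (p, y) @[y --> x] --> F (p, x).
  apply: (@cvg_comp _ _ _ (fun y => (p, y)) F _ _ _ _ (proj1 (Fp x))).
  by apply: cvg_to_pair => /=; [exact: cvg_cst|exact: cvg_id].
split; first by apply: continuous_subspaceT => x; exact: Fc.
move=> c d j Ac Ad.
apply: (@smooth_germ_Cinfty _ _ _ (cset c) _ (fun y => cfun d (F (y.1, cinv c y.2)) 0 j) p).
  by apply: rep_dom_relopen => //; [exact: openT|exact: (proj1 okM)|exact: (proj1 okN)].
move=> _ [x [[_ cx] dx] <-].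
exact: (proj2 (Fp x) d j Ad dx c Ac cx).
Qed.

Lemma smooth_family_param {P : topologicalType} (u : P -> N) (z : P * M) : continuous u ->
  smooth_family AM AN (fun y => u y.1) z.
Proof.
move=> uc; split.
  by apply: (@cvg_comp _ _ _ fst u _ _ _ _ (uc z.1)); exact: cvg_fst.
move=> d j Ad dz c _ _; apply: (@chart_smooth_fst _ _ _ _ _ (fun p => cfun d (u p) 0 j)).
have dok := proj1 okN _ Ad; have [dn _ _ _ _] := dok _ dz.
have {}dn := near_cvg (uc z.1) dn.
apply: filterS dn => p dp; have [_ _ dc _ _] := dok _ dp.
apply: cvg_coord.
apply: (@cvg_comp _ _ _ u (cfun d) _ _ _ (uc p)).
apply: cvg_trans dc _; exact: cvg_within.
Qed.

(** For maps built by a formula in the coordinates of one chart [d0]. In any other chart [d] the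
    representative is the transition map [rep d0 d idfun] after [Y], hence the hypothesis on
    [idfun]. *)
Lemma smooth_family_cinv {P : topologicalType} (Y : P * M -> 'rV[R]_n) d0 b (z : P * M) :
  smooth_on AN AN [set: N] idfun -> AN d0 -> cdom d0 b -> Y z = cfun d0 b ->
  (\forall y \near z, sector (cset d0) (Y y)) ->
  (forall j, smooth_fun AM (fun y => Y y 0 j) z) ->
  (forall j, {for z, continuous (fun y => Y y 0 j)}) ->
  smooth_family AM AN (fun y => cinv d0 (Y y)) z.
Proof.
move=> [_ trans] Ad0 d0b Yz JY Ysm Yc.
have d0ok := proj1 okN _ Ad0; have [_ d0K _ _ d0c] := d0ok _ d0b.
have Ycz : Y @ z --> Y z by apply: cvg_rV => j; exact: Yc.
have YJ : Y @ z --> sectn d0 (cfun d0 b).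
  move=> Q nQ; have {}nQ : \forall v \near Y z, sector (cset d0) v -> Q v by rewrite Yz.
  suff : \forall y \near z, Q (Y y) by [].
  by apply: filterS2 JY (near_cvg Ycz nQ) => y Jy; exact.
split; first by rewrite Yz d0K; exact: (cvg_comp _ _ YJ d0c).
move=> d j Ad; rewrite Yz d0K => db c Ac cz.
have cok := proj1 okM _ Ac; have dok := proj1 okN _ Ad.
have [_ cK _ _ _] := cok _ cz.
have zE : (z.1, cinv c (cfun c z.2)) = z by rewrite cK -surjective_pairing.
have cv := cinv_pair_cvg (p := z.1) cok cz; rewrite -surjective_pairing in cv.
pose F' (y : P * 'rV[R]_m) := Y (y.1, cinv c y.2).
apply: (@smooth_germ_comp _ _ _ _ _ (cset d0) F' (fun y => rep d0 d idfun j y.2)).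
- exact: chart_sector.
- exact: (near_cvg cv JY).
- by move=> i; exact: Ysm.
- apply: (@Cinfty_smooth_germ _ _ _ _ (rep_dom d0 d [set: N] idfun)); last exact: trans.
    by apply: rep_dom_relopen => //; exact: openT.
  by rewrite /F' /= zE Yz; exists b.
Qed.

End SmoothMapsAsFamilies.

(** * Products of atlases *)

Section Products.
Context {R : realType} {N1 N2 : topologicalType} {n1 n2 : nat}.
Variables (A1 : atlas R N1 n1) (A2 : atlas R N2 n2).
Hypotheses (ok1 : atlas_ok A1) (ok2 : atlas_ok A2).

Lemma sector_prod (c : chart R N1 n1) (d : chart R N2 n2) (v : 'rV[R]_(n1 + n2)) :
  sector (cset (chart_prod c d)) v <->
  sector (cset c) (lsubmx v) /\ sector (cset d) (rsubmx v).
Proof.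
split=> [Jv|[Jl Jr] k].
  split=> i iJ; rewrite mxE; apply: Jv; rewrite inE.
    case: splitP => k /= E; first by rewrite -(val_inj E).
    by have := ltn_ord i; rewrite E ltnNge leq_addr.
  case: splitP => k /= E; first by have := ltn_ord k; rewrite -E ltnNge leq_addr.
  by move/eqP: E; rewrite eqn_add2l => /eqP/val_inj <-.
rewrite inE; case: splitP => [i|i] E iJ.
  by have := Jl i iJ; rewrite mxE; congr (0 <= v _ _); apply: val_inj.
by have := Jr i iJ; rewrite mxE; congr (0 <= v _ _); apply: val_inj.
Qed.

Lemma chart_prod_ok (c : chart R N1 n1) (d : chart R N2 n2) :
  chart_ok c -> chart_ok d -> chart_ok (chart_prod c d).
Proof.
move=> cok dok [x y] [/= cx dy].
have [cn cK cc ci cic] := cok x cx; have [dn dK dc di dic] := dok y dy.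
pose w := row_mx (cfun c x) (cfun d y).
have lw : lsubmx @ within (sector (cset (chart_prod c d))) (nbhs w) --> sectn c (cfun c x).
  move=> Q nQ; have {}nQ : nbhs (lsubmx w) (fun v => sector (cset c) v -> Q v) by rewrite row_mxKl.
  suff : nbhs w (fun v => sector (cset (chart_prod c d)) v -> Q (lsubmx v)) by [].
  have lc : lsubmx @ w --> lsubmx w.
    apply: (@cvg_rV _ _ _ (nbhs w)) => j; under eq_fun do rewrite mxE; rewrite mxE; exact: coord_continuous.
  by have := near_cvg lc nQ; apply: filterS => v Qv /sector_prod [Jl _]; exact: Qv.
have rw : rsubmx @ within (sector (cset (chart_prod c d))) (nbhs w) --> sectn d (cfun d y).
  move=> Q nQ; have {}nQ : nbhs (rsubmx w) (fun v => sector (cset d) v -> Q v) by rewrite row_mxKr.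
  suff : nbhs w (fun v => sector (cset (chart_prod c d)) v -> Q (rsubmx v)) by [].
  have rc : rsubmx @ w --> rsubmx w.
    apply: (@cvg_rV _ _ _ (nbhs w)) => j; under eq_fun do rewrite mxE; rewrite mxE; exact: coord_continuous.
  by have := near_cvg rc nQ; apply: filterS => v Qv /sector_prod [_ Jr]; exact: Qv.
split => /=.
- by exists (cdom c, cdom d).
- by rewrite row_mxKl row_mxKr cK dK.
- have fc : (fun z : N1 * N2 => row_mx (cfun c z.1) (cfun d z.2)) @ (x, y) --> w.
    apply: cvg_rV => j; rewrite mxE.
    have -> : (fun t : N1 * N2 => row_mx (cfun c t.1) (cfun d t.2) 0 j) =
      fun t => match fintype.split j with inl j1 => cfun c t.1 0 j1 | inr j2 => cfun d t.2 0 j2 end.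
      by apply/funext => t; rewrite mxE.
    case: (fintype.split j) => k; apply: cvg_coord.
      apply: (@cvg_comp _ _ _ fst (cfun c)); first exact: cvg_fst.
      by apply: cvg_trans cc _; exact: cvg_within.
    apply: (@cvg_comp _ _ _ snd (cfun d)); first exact: cvg_snd.
    by apply: cvg_trans dc _; exact: cvg_within.
  move=> Q nQ; have {}nQ : nbhs w (fun v => sector (cset (chart_prod c d)) v -> Q v) := nQ.
  suff : nbhs (x, y) (fun z : N1 * N2 => Q (row_mx (cfun c z.1) (cfun d z.2))) by [].
  have nd : \forall z \near (x, y), cdom c z.1 /\ cdom d z.2 by exists (cdom c, cdom d).
  apply: filterS2 nd (near_cvg fc nQ) => z [cz dz]; apply; apply/sector_prod.
  by rewrite row_mxKl row_mxKr; split; exact: chart_sector.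
- apply: filterS2 (near_cvg lw ci) (near_cvg rw di) => v [cv cvK] [dv dvK].
  by split=> //; rewrite cvK dvK hsubmxK.
- by apply: cvg_to_pair => /=; [exact: (cvg_comp _ _ lw cic)|exact: (cvg_comp _ _ rw dic)].
Qed.

Lemma atlas_prod_ok : atlas_ok (atlas_prod A1 A2).
Proof.
split; first by move=> _ [c Ac [d Ad <-]]; apply: chart_prod_ok; [exact: (proj1 ok1)|exact: (proj1 ok2)].
move=> [x y]; have [c Ac cx] := proj2 ok1 x; have [d Ad dy] := proj2 ok2 y.
by exists (chart_prod c d) => //; exists c => //; exists d.
Qed.

Context {P M : topologicalType} {m : nat} (AM : atlas R M m).

Lemma smooth_family_pair (F1 : P * M -> N1) (F2 : P * M -> N2) z :
  smooth_family AM A1 F1 z -> smooth_family AM A2 F2 z ->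
  smooth_family AM (atlas_prod A1 A2) (fun y => (F1 y, F2 y)) z.
Proof.
move=> [F1c F1z] [F2c F2z]; split; first exact: cvg_to_pair.
move=> _ j [c Ac [d Ad <-]] [/= cz dz].
have -> : (fun y => row_mx (cfun c (F1 y)) (cfun d (F2 y)) 0 j) =
    fun y => match fintype.split j with inl j1 => cfun c (F1 y) 0 j1 | inr j2 => cfun d (F2 y) 0 j2 end.
  by apply/funext => y; rewrite mxE.
by case: (fintype.split j) => k; [exact: F1z|exact: F2z].
Qed.

Lemma smooth_family_snd_of_prod (F : P * M -> N1 * N2) z :
  smooth_family AM (atlas_prod A1 A2) F z -> smooth_family AM A2 (fun y => (F y).2) z.
Proof.
move=> [Fc Fz]; split; first by apply: (cvg_comp _ _ Fc); exact: cvg_snd.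
move=> d j Ad dz; have [c Ac cz] := proj2 ok1 (F z).1.
have := Fz (chart_prod c d) (rshift n1 j).
have -> : (fun y => cfun (chart_prod c d) (F y) 0 (rshift n1 j)) = fun y => cfun d (F y).2 0 j.
  by apply/funext => y /=; rewrite row_mxEr.
by apply => //; exists c => //; exists d.
Qed.

End Products.

(** * The C^oo topology on diffeomorphisms *)

Section Boxes.
Context {R : realType} {n : nat}.
Variable J : {set 'I_n}.

Definition box (w : 'rV[R]_n) (r : R) : set 'rV[R]_n :=
  [set v | sector J v /\ forall j, `|v 0 j - w 0 j| <= r].

Lemma box_compact w r : compact (box w r).
Proof.
pose K j : set R := [set t | (j \in J -> 0 <= t) /\ `|t - w 0 j| <= r].
have -> : box w r = [set v | forall j, K j (v ord0 j)].
  apply/seteqP; split => v /=.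
    by move=> [Jv vr] j; split; [exact: Jv|exact: vr].
  move=> vK; split=> [j jJ|j]; first by case: (vK j) => + _; apply.
  by case: (vK j).
apply: rV_compact => j.
have -> : K j = `[w 0 j - r, w 0 j + r] `&` [set t | j \in J -> 0 <= t].
  apply/seteqP; split => t; rewrite /K /= in_itv /= ler_distl.
    by move=> [? ?]; split.
  by move=> [? ?]; split.
apply: compact_closedI; first exact: segment_compact.
have [jJ|jJ] := boolP (j \in J).
  have -> : [set t : R | true -> 0 <= t] = [set t | 0 <= t].
    by apply/seteqP; split => t //=; apply.
  exact: closed_ge.
have -> : [set t : R | false -> 0 <= t] = setT by apply/seteqP; split.
exact: closedT.
Qed.

End Boxes.

Section ChartBoxes.
Context {R : realType} {M : topologicalType} {m : nat} (c : chart R M m).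
Hypothesis cok : chart_ok c.

Lemma chart_box x (N : set M) : cdom c x -> nbhs x N ->
  exists2 r : R, 0 < r & forall v, box (cset c) (cfun c x) r v ->
    [/\ cdom c (cinv c v), cfun c (cinv c v) = v & N (cinv c v)].
Proof.
move=> cx Nx; have [_ _ _ ci cic] := cok cx.
have nv : \forall v \near sectn c (cfun c x),
    [/\ cdom c (cinv c v), cfun c (cinv c v) = v & N (cinv c v)].
  by apply: filterS2 ci (near_cvg cic Nx) => v [].
have nv' : \forall y \near snbhs (cset c) (x, cfun c x),
    [/\ cdom c (cinv c y.2), cfun c (cinv c y.2) = y.2 & N (cinv c y.2)].
  have sn : snd @ snbhs (cset c) (x, cfun c x) --> sectn c (cfun c x) := @snd_snbhs _ _ _ _ _.
  exact: (near_cvg sn nv).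
have [e e0 eP] := snbhs_box nv'.
(* The closed box of half the radius lies in the open box. *)
exists (e / 2); first by rewrite divr_gt0.
move=> v [Jv vr]; apply: (eP v Jv) => i; apply: le_lt_trans (vr i) _.
by rewrite gtr_pMr // invf_lt1 // ltr1n.
Qed.

Lemma cinv_box_compact w r :
  (forall v, box (cset c) w r v -> cdom c (cinv c v) /\ cfun c (cinv c v) = v) ->
  compact (cinv c @` box (cset c) w r).
Proof.
move=> H; apply: continuous_compact; last exact: box_compact.
apply/subspace_continuousP => v bv; have [cv vK] := H v bv.
have [_ _ _ _] := cok cv; rewrite vK => cic Q /cic nQ.
have {}nQ : nbhs v (fun u => sector (cset c) u -> Q (cinv c u)) := nQ.
suff : nbhs v (fun u => box (cset c) w r u -> Q (cinv c u)) by [].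
by apply: filterS nQ => u Qu [Ju _]; exact: Qu.
Qed.

Lemma cinv_box_nbhs x r : cdom c x -> 0 < r -> nbhs x (cinv c @` box (cset c) (cfun c x) r).
Proof.
move=> cx r0; have [cn cK cc _ _] := cok cx.
have nb : \forall v \near sectn c (cfun c x), box (cset c) (cfun c x) r v.
  have nJ : \forall v \near sectn c (cfun c x), sector (cset c) v by exact: withinT.
  have nr : \forall v \near sectn c (cfun c x), forall j, `|(v : 'rV[R]_m) 0 j - cfun c x 0 j| <= r.
    apply: filter_forall => j.
    have : v 0 j @[v --> cfun c x] --> cfun c x 0 j by exact: coord_continuous.
    move=> /cvg_ballP /(_ r r0) H.
    have := @cvg_within _ _ (nbhs_filter (cfun c x)) (sector (cset c)) _ H.
    by apply: filterS => v; rewrite /ball /= distrC => /ltW.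
  by apply: filterS2 nJ nr => v.
apply: filterS2 cn (near_cvg cc nb) => y cy byr.
by exists (cfun c y) => //; have [_ -> _ _ _] := cok cy.
Qed.

(** Local compactness provides the compact sets on which the subbasic neighbourhoods of the C^oo
    topology are tested. *)
Lemma chart_compact_nbhs x (N : set M) : cdom c x -> nbhs x N ->
  exists L : set M, [/\ compact L, nbhs x L & L `<=` cdom c `&` N].
Proof.
move=> cx Nx; have [r r0 rP] := chart_box cx Nx.
exists (cinv c @` box (cset c) (cfun c x) r); split.
- by apply: cinv_box_compact => v /rP [].
- exact: cinv_box_nbhs.
- by move=> _ [v /rP [cv _ Nv] <-].
Qed.

End ChartBoxes.

Section DiffeoTopology.
Context {R : realType} {M : topologicalType} {m : nat} (A : atlas R M m).

Lemma open_Cinfty_subbase (V : set (diffeo A)) : Cinfty_subbase V -> open V.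
Proof.
move=> VB; exists [set V]; last by rewrite bigcup_set1.
move=> _ ->; exists [fset V]%fset; first by move=> U; rewrite inE => /eqP ->; exact: mem_set.
by rewrite set_fset1 bigcap_set1.
Qed.

Lemma diffeo_continuous (P : topologicalType) (F : P -> diffeo A) :
  (forall V p, Cinfty_subbase V -> V (F p) -> \forall q \near p, V (F q)) -> continuous F.
Proof.
move=> H p Q; rewrite nbhsE => -[W [oW WF] WQ].
suff : \forall q \near p, W (F q) by apply: filterS => q; exact: WQ.
case: oW WF => D' D'B <- [U D'U UF].
have [B BD BE] := D'B _ D'U.
have FB V : V \in B -> nbhs p (fun q => V (F q)).
  move=> VB; apply: H; first exact: set_mem (BD V VB).
  by move: UF; rewrite -BE; apply.
have HB : nbhs p (fun q => forall V, V \in B -> V (F q)).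
  exact: (@filter_bigI P (set (diffeo A)) B (fun V q => V (F q)) (nbhs p) _ FB).
apply: filterS HB => q HB; exists U => //; suff : U (F q) by [].
by rewrite -BE => V VB; exact: HB.
Qed.

End DiffeoTopology.

(** A derivative at a parameter sees only the slice over that parameter, so even the parameter space
    can be exchanged. *)
Lemma eq_is_pder_slice {R : realType} {P P' : topologicalType} {n : nat} (J : {set 'I_n})
    (G : P * 'rV[R]_n -> R) (G' : P' * 'rV[R]_n -> R) p p' v i :
  (forall u, G (p, u) = G' (p', u)) ->
  is_pder J i G' (p', v) (pder J i G' (p', v)) -> is_pder J i G (p, v) (pder J i G (p, v)).
Proof.
move=> GG'; rewrite /is_pder /pder /dquot /=.
by have -> : (fun u => G (p, u)) = (fun u => G' (p', u)) by apply/funext.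
Qed.

(** * Continuous maps into the diffeomorphisms are the smooth families *)

Section DiffeoFamilies.
Context {R : realType} {M : topologicalType} {m : nat} (A : atlas R M m).
Hypothesis okA : atlas_ok A.
Context {P : topologicalType}.
Implicit Types (c d : chart R M m) (x : M) (p : P).

Lemma diffeo_cvg (f : diffeo A) x : f @ x --> f x.
Proof. by case: (diffeoP f) => [[fc _] _]; exact: (within_open_cvg openT fc). Qed.

Lemma diffeo_rep_relopen c d (f : diffeo A) : A c -> A d ->
  relopen (cset c) (rep_dom c d [set: M] f).
Proof.
move=> Ac Ad; apply: rep_dom_relopen; first exact: openT.
- by move=> x _; exact: diffeo_cvg.
- exact: (proj1 okA).
- exact: (proj1 okA).
Qed.

Lemma rep_dom_mem c d (f : diffeo A) x : cdom c x -> cdom d (f x) ->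
  rep_dom c d [set: M] f (cfun c x).
Proof. by move=> cx dx; exists x. Qed.

Lemma diffeo_smooth_germ c d j (f : diffeo A) p x : A c -> A d -> cdom c x -> cdom d (f x) ->
  smooth_germ (cset c) (fun y : P * 'rV[R]_m => rep c d f j y.2) (p, cfun c x).
Proof.
move=> Ac Ad cx dx; case: (diffeoP f) => [[_ fC] _].
apply: (@Cinfty_smooth_germ _ _ _ _ (rep_dom c d [set: M] f)) (fC c d j Ac Ad).
  exact: diffeo_rep_relopen.
exact: rep_dom_mem.
Qed.

Section Tautological.
Variable F : P -> diffeo A.
Hypothesis Fc : continuous F.

Lemma family_dom d p x : A d -> cdom d (F p x) ->
  \forall y \near (p, x), cdom d (F y.1 y.2).
Proof.
move=> Ad dx; have [c Ac cx] := proj2 okA x.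
have dn : \forall x' \near x, cdom d (F p x').
  have [dn _ _ _ _] := proj1 okA _ Ad _ dx.
  exact: (near_cvg (@diffeo_cvg (F p) x) dn).
have [L [cL xL LN]] := chart_compact_nbhs (proj1 okA _ Ac) cx dn.
(* The purpose of this neighbourhood is its condition that [L] is mapped into the domain of [d]; the
   order [0] and the bound [1] are arbitrary. *)
pose V := Cinfty_nbhd (F p) c d L 0 1.
have oV : open V by apply: open_Cinfty_subbase; exists (F p), c, d, L, 0%N, 1; split.
have VF : V (F p).
  split; first by move=> x' /LN [].
  by move=> w j x' _ _; rewrite subrr normr0.
have nV : \forall q \near p, V (F q) by apply: Fc; exact: open_nbhs_nbhs.
exists ([set q | V (F q)], L) => //= -[q x'] [/= [LV _] Lx']; exact: LV.
Qed.

(** Two errors of [e / 2]: nearness of [F q] to [F p] in the C^oo topology, uniform on a compact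
    neighbourhood of [x], and continuity of the derivative of the single diffeomorphism [F p]. *)
Lemma family_pders c d j w p x : A c -> A d -> cdom c x -> cdom d (F p x) ->
  scont (cset c) (pders (cset c) w (fun y => rep c d (F y.1) j y.2)) (p, cfun c x).
Proof.
move=> Ac Ad cx dx; have cok := proj1 okA _ Ac.
have [_ cK _ _ _] := cok _ cx.
set G := fun y : P * 'rV[R]_m => rep c d (F y.1) j y.2.
have dn : \forall x' \near x, cdom d (F p x').
  have [dn _ _ _ _] := proj1 okA _ Ad _ dx.
  exact: (near_cvg (@diffeo_cvg (F p) x) dn).
have [L [cL xL LN]] := chart_compact_nbhs cok cx dn.
have GE q x' : cdom c x' -> cdom d (F q x') -> pders (cset c) w G (q, cfun c x') =
    partials (rep_dom c d [set: M] (F q)) w (rep c d (F q) j) (cfun c x').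
  move=> cx' dx'; rewrite (pders_local w G q (diffeo_rep_relopen (F q) Ac Ad)) //.
  exact: rep_dom_mem.
apply/cvg_ballP => e e0; have e20 : 0 < e / 2 by rewrite divr_gt0.
pose V := Cinfty_nbhd (F p) c d L (size w) (e / 2).
have oV : open V by apply: open_Cinfty_subbase; exists (F p), c, d, L, (size w), (e / 2); split.
have VF : V (F p).
  split; first by move=> x' /LN [].
  by move=> w' j' x' _ _; rewrite subrr normr0.
have nV : \forall q \near p, V (F q) by apply: Fc; exact: open_nbhs_nbhs.
have nV' := near_cvg (@fst_snbhs _ _ _ (cset c) (p, cfun c x)) nV.
have nL : \forall y \near snbhs (cset c) (p, cfun c x), L (cinv c y.2).
  have sL : \forall y \near (p, x), L y.2 by apply: near_snd.
  exact: (near_cvg (cinv_pair_cvg (p := p) cok cx) sL).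
have nK := @cfun_cinv_near _ P _ _ c p x cok cx.
have Jx : sector (cset c) (cfun c x) by exact: chart_sector.
have := smooth_germ_scont (z := (p, cfun c x)) Jx (smooth_germ_pders w (diffeo_smooth_germ j p Ac Ad cx dx)).
move=> /cvg_ballP /(_ _ e20) nG.
have nLK : \forall y \near snbhs (cset c) (p, cfun c x),
   [/\ L (cinv c y.2), cdom c (cinv c y.2) & cfun c (cinv c y.2) = y.2].
  by apply: filterS2 nL nK => y ? [].
apply: filterS3 nV' nLK nG => -[q v] /= [LV Vq] [Lv cv vK].
have dq : cdom d (F q (cinv c v)) by exact: LV.
have [_ dp] := LN _ Lv.
have := Vq w j (cinv c v) (leqnn _) Lv; rewrite vK /ball /= => H1.
rewrite -[v]vK (GE q) // (GE p) // vK.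
set Gp := fun y : P * 'rV[R]_m => rep c d (F p) j y.2.
have GpE x' : cdom c x' -> cdom d (F p x') -> pders (cset c) w Gp (q, cfun c x') =
    partials (rep_dom c d [set: M] (F p)) w (rep c d (F p) j) (cfun c x').
  move=> cx' dx'; rewrite (pders_local w Gp q (diffeo_rep_relopen (F p) Ac Ad)) //.
  exact: rep_dom_mem.
have GpE' : pders (cset c) w Gp (p, cfun c x) =
    partials (rep_dom c d [set: M] (F p)) w (rep c d (F p) j) (cfun c x).
  rewrite (pders_local w Gp p (diffeo_rep_relopen (F p) Ac Ad)) //.
  exact: rep_dom_mem.
rewrite -[v in pders _ _ _ (q, v)]vK (GpE _ cv dp) GpE' vK => H2.
apply: le_lt_trans (ler_distD (partials (rep_dom c d [set: M] (F p)) w (rep c d (F p) j) v) _ _) _.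
by rewrite (splitr e); apply: ltrD => //; rewrite distrC.
Qed.

Lemma diffeo_smooth_family z : smooth_family A A (fun y => F y.1 y.2) z.
Proof.
case: z => p x.
have [d0 Ad0 dx0] := proj2 okA (F p x); have d0ok := proj1 okA _ Ad0.
have [c0 Ac0 cx0] := proj2 okA x; have c0ok := proj1 okA _ Ac0.
split.
  have Yc : (fun y => cfun d0 (F y.1 y.2)) @ (p, x) --> cfun d0 (F p x).
    apply: cvg_rV => j.
    (* The empty word gives joint continuity of the coordinates. *)
    have := family_pders (j := j) (w := [::]) Ac0 Ad0 cx0 dx0; rewrite /scont /= /rep /=.
    have [_ c0K _ _ _] := c0ok _ cx0; rewrite c0K => H.
    have := cvg_comp _ _ (cfun_pair_cvg (p := p) c0ok cx0) H.
    apply: cvg_trans; apply: near_eq_cvg.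
    have [c0n _ _ _ _] := c0ok _ cx0.
    have c0n' : \forall y \near (p, x), cdom c0 y.2.
      by apply: near_snd.
    by apply: filterS c0n' => y cy /=; have [_ -> _ _ _] := c0ok _ cy.
  have [_ d0K _ _ d0c] := d0ok _ dx0.
  have nd := family_dom Ad0 dx0.
  have YJ : (fun y => cfun d0 (F y.1 y.2)) @ (p, x) --> sectn d0 (cfun d0 (F p x)).
    move=> Q nQ; have {}nQ : \forall v \near cfun d0 (F p x), sector (cset d0) v -> Q v := nQ.
    suff : \forall y \near (p, x), Q (cfun d0 (F y.1 y.2)) by [].
    apply: filterS2 nd (near_cvg Yc nQ) => y dy; apply; exact: chart_sector.
  have := cvg_comp _ _ YJ d0c.
  apply: cvg_trans; apply: near_eq_cvg.
  by apply: filterS nd => y dy /=; have [_ -> _ _ _] := d0ok _ dy.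
move=> d j Ad /= dx c Ac cx; have cok := proj1 okA _ Ac.
move=> k; apply: Ck_words => w.
have nd := near_cvg (cinv_pair_cvg (p := p) cok cx) (family_dom Ad dx).
apply: filterS2 nd (@cfun_cinv_near _ P _ _ c p x cok cx) => -[q v] /= dv [cv vK].
split; first by rewrite -vK; exact: family_pders.
move=> i; rewrite -vK.
(* Existence of the derivative concerns the single diffeomorphism [F q], so it is read off from the
   family that is constantly [F q]. *)
apply: (@eq_is_pder_slice _ _ P _ _ _ (pders (cset c) w (fun y : P * 'rV[R]_m => rep c d (F q) j y.2)) q q).
  by move=> u; rewrite !pdersE.
apply: smooth_germ_is_pder; first exact: chart_sector.
by apply: smooth_germ_pders; exact: diffeo_smooth_germ.
Qed.

End Tautological.

(** Compactness of [L] turns estimates near each [(p, x)] into one neighbourhood of [p] that serves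
    all of [L]. *)
Lemma continuous_diffeo_smooth_family (F : P -> diffeo A) :
  (forall z, smooth_family A A (fun y => F y.1 y.2) z) -> continuous F.
Proof.
move=> Fsm; apply: diffeo_continuous => _ p [f [c [d [L [k [e [[Ac Ad] cL Lcd e0 ->]]]]]]].
move=> [LF FL].
have cok := proj1 okA _ Ac; have dok := proj1 okA _ Ad.
(* Words of length at most [k] are gathered in the finite type [k.-bseq 'I_m], because only finitely
   many conditions can be intersected in a neighbourhood filter. *)
suff : \forall q \near p, L `<=` [set x | cdom d (F q x) /\
   forall (w : k.-bseq 'I_m) (j : 'I_m),
     `| partials (rep_dom c d [set: M] (F q)) w (rep c d (F q) j) (cfun c x)
        - partials (rep_dom c d [set: M] f) w (rep c d f j) (cfun c x) | < e].
  apply: filterS => q LQ; split; first by move=> x /LQ [].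
  move=> w j x wk Lx; have [_ H] := LQ x Lx.
  exact: (H (Bseq wk) j).
have := cL; rewrite compact_near_coveringP => ncL; apply: ncL => x Lx.
have [cx dfx] := Lcd x Lx; have dFx : cdom d (F p x) := LF x Lx.
have [cn _ _ _ _] := cok _ cx.
have nc : \forall y \near (p, x), cdom c y.2.
  by apply: near_snd.
have nd : \forall y \near (p, x), cdom d (F y.1 y.2).
  exact: (@smooth_family_dom _ P M M m m A A okA (fun y => F y.1 y.2) (p, x) d Ad dFx (Fsm (p, x))).
have ndf : \forall y \near (p, x), cdom d (f y.2).
  have [dn _ _ _ _] := dok _ dfx.
  have fc : (fun y : P * M => f y.2) @ (p, x) --> f x.
    by apply: (@cvg_comp _ _ _ snd f _ _ _ _ (@diffeo_cvg f x)); exact: cvg_snd.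
  exact: (near_cvg fc dn).
have nE : \forall y \near (p, x), forall (w : k.-bseq 'I_m) (j : 'I_m),
    `| partials (rep_dom c d [set: M] (F y.1)) w (rep c d (F y.1) j) (cfun c y.2)
        - partials (rep_dom c d [set: M] f) w (rep c d f j) (cfun c y.2) | < e.
  apply: (@filter_forall _ _ _ (nbhs (p, x))) => w; apply: (@filter_forall _ _ _ (nbhs (p, x))) => j.
  pose G := fun y : P * 'rV[R]_m => rep c d (F y.1) j y.2.
  pose H := fun y : P * 'rV[R]_m => rep c d f j y.2.
  have Jx : sector (cset c) (cfun c x) by exact: chart_sector.
  have Gc : scont (cset c) (pders (cset c) w G) (p, cfun c x).
    apply: smooth_germ_scont => //; apply: smooth_germ_pders.
    exact: (proj2 (Fsm (p, x)) d j Ad dFx c Ac cx).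
  have Hc : scont (cset c) (pders (cset c) w H) (p, cfun c x).
    by apply: smooth_germ_scont => //; apply: smooth_germ_pders; exact: diffeo_smooth_germ.
  have GHc : `|pders (cset c) w G y - pders (cset c) w H y| @[y --> snbhs (cset c) (p, cfun c x)]
      --> `|pders (cset c) w G (p, cfun c x) - pders (cset c) w H (p, cfun c x)|.
    by apply: cvg_norm; exact: cvgB.
  have GE q x' : cdom c x' -> cdom d (F q x') -> pders (cset c) w G (q, cfun c x') =
      partials (rep_dom c d [set: M] (F q)) w (rep c d (F q) j) (cfun c x').
    move=> cx' dx'; rewrite (pders_local w G q (diffeo_rep_relopen (F q) Ac Ad)) //.
    exact: rep_dom_mem.
  have HE q x' : cdom c x' -> cdom d (f x') -> pders (cset c) w H (q, cfun c x') =
      partials (rep_dom c d [set: M] f) w (rep c d f j) (cfun c x').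
    move=> cx' dx'; rewrite (pders_local w H q (diffeo_rep_relopen f Ac Ad)) //.
    exact: rep_dom_mem.
  (* The neighbourhood is centred at [f], which need not be [F p]; the strict inequality at [(p, x)]
     persists nearby since both derivatives are continuous. *)
  have lt_e := FL w j x (size_bseq w) Lx; rewrite -GE // -(HE p) // in lt_e.
  have nlt := near_cvg (cfun_pair_cvg (p := p) cok cx) (cvgr_lt _ GHc _ lt_e).
  have ncd : \forall y \near (p, x), [/\ cdom c y.2, cdom d (F y.1 y.2) & cdom d (f y.2)].
    by apply: filterS3 nc nd ndf.
  apply: filterS2 ncd (nlt (snbhs_filter _ _)) => y [cy dy dfy].
  by rewrite -GE // -(HE y.1).
have nP : \forall y \near (p, x), cdom d (F y.1 y.2) /\ forall (w : k.-bseq 'I_m) (j : 'I_m),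
    `| partials (rep_dom c d [set: M] (F y.1)) w (rep c d (F y.1) j) (cfun c y.2)
        - partials (rep_dom c d [set: M] f) w (rep c d f j) (cfun c y.2) | < e.
  by apply: filterS2 nd nE.
have sw : (fun y : M * P => (y.2, y.1)) @ (x, p) --> (p, x).
  by apply: cvg_to_pair => /=; [exact: cvg_snd|exact: cvg_fst].
exact: (near_cvg sw nP).
Qed.

End DiffeoFamilies.

(** * Transport between nearby fibres *)

Lemma smooth_fun_continuous {R : realType} {P M : topologicalType} {m : nat} (A : atlas R M m)
    (u : P * M -> R) z : atlas_ok A -> smooth_fun A u z -> {for z, continuous u}.
Proof.
move=> okA uz; have [c Ac cz] := proj2 okA z.2; have cok := proj1 okA _ Ac.
have [cn cK _ _ _] := cok _ cz.
have H : u (y.1, cinv c y.2) @[y --> snbhs (cset c) (z.1, cfun c z.2)]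
    --> u (z.1, cinv c (cfun c z.2)).
  exact: (@smooth_germ_scont _ _ _ _ _ (z.1, cfun c z.2) (chart_sector cok cz) (uz c Ac cz)).
rewrite cK -surjective_pairing in H.
have := cvg_comp _ _ (cfun_pair_cvg (p := z.1) cok cz) H.
rewrite -[in X in X -> _]surjective_pairing.
apply: cvg_trans; apply: near_eq_cvg.
have cn' : \forall y \near z, cdom c y.2.
  by apply: near_snd.
by apply: filterS cn' => y cy /=; have [_ -> _ _ _] := cok _ cy; rewrite -surjective_pairing.
Qed.

(** * Bump functions with exact plateaus *)

Section Bump.
Context {R : realType}.

Lemma flat0_mono (x y : R) : x <= y -> flat 0 x <= flat 0 y.
Proof.
move=> xy; rewrite /flat !expr0 !mul1r; case: ifPn => [x0|x0]; last by case: ifP => // _; exact: expR_ge0.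
by rewrite (lt_le_trans x0 xy) ler_expR lerN2 lef_pV2 // posrE // (lt_le_trans x0).
Qed.

(** The factor [expR 1] normalizes [flat 0] to the value [1] at [1], which makes the upper plateau
    of [bump] exactly [1]. *)
Lemma flat0_1 : expR 1 * flat 0 (1 : R) = 1.
Proof. by rewrite /flat ltr01 expr0 mul1r invr1 -expRD subrr expR0. Qed.

(* Both plateaus come from [flat 0] vanishing on the negative half-line. *)
Definition bump (h y : R) : R := expR 1 * flat 0 (1 - expR 1 * flat 0 (2 * y / h - 1)).

Lemma bump_ge0 h y : 0 <= bump h y.
Proof. by rewrite mulr_ge0 ?expR_ge0 // flat_ge0. Qed.

Lemma bump_le1 h y : bump h y <= 1.
Proof.
rewrite -[leRHS]flat0_1; apply: ler_wpM2l; first exact: expR_ge0.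
by apply: flat0_mono; rewrite gerBl mulr_ge0 ?expR_ge0 // flat_ge0.
Qed.

Lemma bump_eq1 h y : 0 < h -> y <= h / 2 -> bump h y = 1.
Proof.
move=> h0 yh; rewrite /bump [flat 0 (_ - 1)](_ : _ = 0) ?mulr0 ?subr0 ?flat0_1 //.
rewrite /flat ltNge [_ <= 0](_ : _ = true) //.
by rewrite subr_le0 ler_pdivrMr // mul1r -ler_pdivlMl // mulrC.
Qed.

Lemma bump_eq0 h y : 0 < h -> h <= y -> bump h y = 0.
Proof.
move=> h0 hy; rewrite /bump [flat 0 (1 - _)](_ : _ = 0) ?mulr0 //.
rewrite /flat ltNge [_ <= 0](_ : _ = true) //.
rewrite subr_le0 -[leLHS]flat0_1; apply: ler_wpM2l; first exact: expR_ge0.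
apply: flat0_mono; rewrite lerBrDr ler_pdivlMr //; lra.
Qed.

Lemma smooth_fun_bump {P M : topologicalType} {m : nat} (A : atlas R M m)
    (u : P * M -> R) z h : atlas_ok A -> smooth_fun A u z -> smooth_fun A (fun y => bump h (u y)) z.
Proof.
move=> okA uz; apply: smooth_funM; first exact: smooth_fun_cst.
apply: smooth_fun_flat => //; apply: smooth_funB => //; first exact: smooth_fun_cst.
apply: smooth_funM; first exact: smooth_fun_cst.
apply: smooth_fun_flat => //; apply: smooth_funB => //; last exact: smooth_fun_cst.
by apply: smooth_funM; [apply: smooth_funM => //; exact: smooth_fun_cst|exact: smooth_fun_cst].
Qed.

End Bump.

Lemma norm_le_of_sqr {R : realType} (x h : R) : 0 <= h -> x ^+ 2 <= h ^+ 2 -> `|x| <= h.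
Proof.
by move=> h0 xh; rewrite -sqrtr_sqr -[leRHS](ger0_norm h0) -sqrtr_sqr ler_wsqrtr.
Qed.

(** * Partial moves along segments of a chart *)

Section ChartStep.
Context {R : realType} {B : topologicalType} {n : nat} (AB : atlas R B n).
Hypothesis mB : manifold_with_corners AB.

(* [mid a b b'] moves [b] towards [b'] along a segment of a chart; how far depends on [a]:
   all the way if [a] is in [W], not at all if [a] is not in [C]. *)
Lemma chart_step (b0 : B) (U : set B) : nbhs b0 U ->
  exists (C V W : set B) (mid : B -> B -> B -> B),
  [/\ closed C, open V /\ V `<=` U, C `<=` V, nbhs b0 W /\ W `<=` C &
   [/\ forall a b b', C a -> V b -> V b' -> V (mid a b b'),
       forall a b b', ~ C a -> mid a b b' = b,
       forall a b, (C a -> V b) -> mid a b b = b,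
       forall a b b', W a -> V b' -> mid a b b' = b' &
       forall (P M : topologicalType) m (AM : atlas R M m) (al be ga : P * M -> B) z,
         atlas_ok AM -> smooth_family AM AB al z -> smooth_family AM AB be z -> smooth_family AM AB ga z ->
         (C (al z) -> V (be z) /\ V (ga z)) ->
         smooth_family AM AB (fun y => mid (al y) (be y) (ga y)) z]].
Proof.
move=> nU; have okB := manifold_atlas_ok mB; have [hausB _ _ _ transB] := mB.
have [c Ac cb0] := proj2 okB b0; have cok := proj1 okB _ Ac.
have [r r0 rP] := chart_box cok cb0 nU.
set w := cfun c b0 in rP.
pose h := r / 2; have h0 : 0 < h by rewrite divr_gt0.
have hr : h < r by rewrite /h gtr_pMr // invf_lt1 // ltr1n.
pose V := [set a | cdom c a /\ forall j, `|cfun c a 0 j - w 0 j| < r].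
pose C := [set a | cdom c a /\ forall j, `|cfun c a 0 j - w 0 j| <= h].
(* The squared Euclidean distance is smooth, unlike the distance that defines the boxes. Outside [C]
   some coordinate differs by more than [h], so [sq a] exceeds [h ^+ 2] and the bump vanishes; below
   [h ^+ 2 / 2], that is on [W], the bump is [1]. *)
pose sq a := \sum_j (cfun c a 0 j - w 0 j) ^+ 2.
pose W := [set a | cdom c a /\ sq a < h ^+ 2 / 2].
have ccvg a j : cdom c a -> cfun c x 0 j @[x --> a] --> cfun c a 0 j.
  move=> ca; have [_ _ cc _ _] := cok _ ca; apply: cvg_coord.
  by apply: cvg_trans cc _; exact: cvg_within.
have cK a : cdom c a -> cinv c (cfun c a) = a by move=> /cok [].
have oV : open V.
  rewrite openE => a [ca Va]; have [cn _ _ _ _] := cok _ ca.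
  have nV : \forall x \near a, forall j, `|cfun c x 0 j - w 0 j| < r.
    apply: (@filter_forall _ _ _ (nbhs a)) => j.
    have H : `|cfun c x 0 j - w 0 j| @[x --> a] --> `|cfun c a 0 j - w 0 j|.
      by apply: cvg_norm; apply: cvgB; [exact: ccvg|exact: cvg_cst].
    exact: (cvgr_lt _ H _ (Va j)).
  by apply: filterS2 cn nV => x cx Vx; split.
have Vbox b : V b -> box (cset c) w r (cfun c b).
  by move=> [cb Vb]; split; [exact: chart_sector|move=> j; exact: ltW].
have boxV v : sector (cset c) v -> (forall j, `|v 0 j - w 0 j| < r) -> V (cinv c v).
  move=> Jv vr; have [|cv vK _] := rP v; first by split=> // j; exact: ltW.
  by split; rewrite ?vK.
have VU : V `<=` U by move=> b Vb; have [_ _] := rP _ (Vbox b Vb); rewrite cK //; case: Vb.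
have CV : C `<=` V by move=> a [ca Ca]; split=> // j; exact: le_lt_trans (Ca j) hr.
have clC : closed C.
  have -> : C = cinv c @` box (cset c) w h.
    apply/seteqP; split => [a [ca Ca]|_ [v [Jv vh] <-]].
      by exists (cfun c a); [split=> //; exact: chart_sector|exact: cK].
    have [|cv vK _] := rP v; last by split; rewrite ?vK.
    by split=> // j; exact: le_trans (vh j) (ltW hr).
  (* [C] has to be closed in all of [B], not only in the domain of the chart: it is the image of a
     compact box, and [B] is Hausdorff. *)
  apply: compact_closed => //; apply: cinv_box_compact => // v [Jv vh].
  have [|cv vK _] := rP v; last by [].
  by split=> // j; exact: le_trans (vh j) (ltW hr).
have sqj a j : (cfun c a 0 j - w 0 j) ^+ 2 <= sq a.
  rewrite /sq (bigD1 j) //= lerDl; apply: sumr_ge0 => i _; exact: sqr_ge0.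
have WC : W `<=` C.
  move=> a [ca Wa]; split=> // j; apply: (norm_le_of_sqr (ltW h0)).
  apply: le_trans (sqj a j) _; apply: le_trans (ltW Wa) _.
  by rewrite ler_pdivrMr // ler_peMr ?ler1n // sqr_ge0.
have nW : nbhs b0 W.
  have [cn _ _ _ _] := cok _ cb0.
  have sqc : sq x @[x --> b0] --> \sum_(j < n) (0 : R).
    apply: cvg_big => //.
      by move=> x; apply: cvgD; [exact: cvg_fst|exact: cvg_snd].
    move=> j _.
    have H : cfun c x 0 j - w 0 j @[x --> b0] --> (0 : R).
      by rewrite -(subrr (w 0 j)); apply: cvgB; [exact: ccvg|exact: cvg_cst].
    have HH : (cfun c x 0 j - w 0 j) ^+ 2 @[x --> b0] --> (0 * 0 : R) by exact: cvgM.
    by rewrite mulr0 in HH.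
  rewrite big1 // in sqc.
  have nsq : \forall x \near b0, sq x < h ^+ 2 / 2.
    have hh : 0 < h ^+ 2 / 2 by rewrite divr_gt0 // exprn_gt0.
    exact: (cvgr_lt _ sqc _ hh).
  by apply: filterS2 cn nsq => x cx sx; split.
pose Y a b b' := cfun c b + bump (h ^+ 2) (sq a) *: (cfun c b' - cfun c b).
pose mid a b b' := if a \in C then cinv c (Y a b b') else b.
have Yconv a b b' : V b -> V b' -> sector (cset c) (Y a b b') /\
    forall j, `|Y a b b' 0 j - w 0 j| < r.
  move=> [cb Vb] [cb' Vb']; have t0 := bump_ge0 (h ^+ 2) (sq a).
  have t1 := bump_le1 (h ^+ 2) (sq a).
  rewrite /Y; set t := bump _ _ in t0 t1 *; split=> [j jJ|j]; rewrite !mxE.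
    have := chart_sector cok cb jJ; have := chart_sector cok cb' jJ.
    by move: (cfun c b 0 j) (cfun c b' 0 j) => x x' ? ?; nra.
  have := Vb j; have := Vb' j; rewrite !ltr_norml.
  move: (cfun c b 0 j) (cfun c b' 0 j) => x x' /andP[? ?] /andP[? ?].
  (* The strict bound for a convex combination needs one weight bounded away from zero, and this is
     [1 - t] or [t]. *)
  have [t2|t2] := lerP t 2^-1; apply/andP; split; nra.
have Y0 a b b' : cdom c a -> ~ C a -> Y a b b' = cfun c b.
  move=> ca nCa; rewrite /Y bump_eq0 ?scale0r ?addr0 ?exprn_gt0 //.
  rewrite leNgt; apply/negP => sqh; apply: nCa; split=> // j.
  exact: (norm_le_of_sqr (ltW h0) (le_trans (sqj a j) (ltW sqh))).
exists C, V, W, mid; split=> //; split.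
- move=> a b b' Ca Vb Vb'; rewrite /mid mem_set //.
  by have [JY Yr] := Yconv a b b' Vb Vb'; exact: boxV.
- by move=> a b b' nCa; rewrite /mid memNset.
- move=> a b CVb; rewrite /mid; case: ifPn => // /set_mem /CVb [cb _].
  by rewrite /Y subrr scaler0 addr0 cK.
- move=> a b b' Wa [cb' _]; rewrite /mid mem_set; last exact: WC.
  rewrite /Y bump_eq1 ?exprn_gt0 //; last by case: Wa => _ /ltW.
  by rewrite scale1r addrC subrK cK.
- move=> P M m AM al be ga z okM sal sbe sga CV'.
  have [Ca|nCa] := pselect (C (al z)); last first.
    apply: (eq_smooth_family okM (F := be)) => //.
    have : \forall y \near z, (~` C) (al y).
      apply: (near_cvg (proj1 sal)); apply: open_nbhs_nbhs; split=> //.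
      exact: closed_openC.
    by apply: filterS => y nCy; rewrite /mid memNset.
  have [Vb Vg] := CV' Ca.
  have nVa : \forall y \near z, V (al y).
    by apply: (near_cvg (proj1 sal)); apply: open_nbhs_nbhs; split=> //; exact: CV.
  have nVb : \forall y \near z, V (be y).
    by apply: (near_cvg (proj1 sbe)); exact: open_nbhs_nbhs.
  have nVg : \forall y \near z, V (ga y).
    by apply: (near_cvg (proj1 sga)); exact: open_nbhs_nbhs.
  (* Near a point of [C] the formula through [Y] also holds off [C], where the bump vanishes and
     both branches of [mid] give [be y]. *)
  apply: (eq_smooth_family okM (F := fun y => cinv c (Y (al y) (be y) (ga y)))).
    apply: filterS2 nVa nVb => y [cy _] [cby _]; rewrite /mid.
    by case: ifPn => // /negP nCy; rewrite Y0 ?cK // => Cy; apply: nCy; exact: mem_set.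
  have [JY Yr] := Yconv (al z) _ _ Vb Vg.
  have sY j : smooth_fun AM (fun y => Y (al y) (be y) (ga y) 0 j) z.
    have sb := proj2 sbe c j Ac (proj1 Vb); have sg := proj2 sga c j Ac (proj1 Vg).
    have -> : (fun y => Y (al y) (be y) (ga y) 0 j) = (fun y => cfun c (be y) 0 j +
       bump (h ^+ 2) (sq (al y)) * (cfun c (ga y) 0 j - cfun c (be y) 0 j)).
      by apply/funext => y; rewrite !mxE.
    apply: smooth_funD => //; apply: smooth_funM; last exact: smooth_funB.
    apply: smooth_fun_bump => //; apply: smooth_fun_sum => i.
    have sa := proj2 sal c i Ac (proj1 (CV _ Ca)).
    by apply: smooth_funM; apply: smooth_funB => //; exact: smooth_fun_cst.
  have [cY YK _] : [/\ cdom c (cinv c (Y (al z) (be z) (ga z))),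
      cfun c (cinv c (Y (al z) (be z) (ga z))) = Y (al z) (be z) (ga z) &
      U (cinv c (Y (al z) (be z) (ga z)))].
    by apply: rP; split=> // j; exact: ltW.
  apply: (smooth_family_cinv okM okB transB Ac cY) => //.
    by apply: filterS2 nVb nVg => y Vby Vgy; case: (Yconv (al y) _ _ Vby Vgy).
  by move=> j; exact: smooth_fun_continuous (sY j).
Qed.

End ChartStep.

(** * Composition of elementary moves *)

Section Transport.
Context {R : realType} {E B : topologicalType} {e n : nat}.
Variables (AE : atlas R E e) (AB : atlas R B n) (p : E -> B).
Hypotheses (mE : manifold_with_corners AE) (mB : manifold_with_corners AB).
Hypothesis hp : smooth_bundle_with_compact_fiber AE AB p.

(* For [ab] in the neighbourhood [D] of the diagonal, [T ab] maps the fibre over [ab.1]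
   to the fibre over [q ab], with inverse [S ab]; over [X] the endpoint [q ab] is [ab.2]. *)
Record transport (X : set B) (D : set (B * B)) (q : B * B -> B) (T S : B * B -> E -> E) :
    Prop := Transport {
  tr_open : open D;
  tr_diag : forall a, D (a, a);
  tr_q_diag : forall a, q (a, a) = a;
  tr_q_eq : forall ab, D ab -> X ab.1 -> q ab = ab.2;
  tr_T : forall ab x, D ab -> p x = ab.1 -> p (T ab x) = q ab /\ S ab (T ab x) = x;
  tr_S : forall ab y, D ab -> p y = q ab -> p (S ab y) = ab.1 /\ T ab (S ab y) = y;
  tr_T_diag : forall x, T (p x, p x) x = x;
  tr_q_smooth : forall (P M : topologicalType) m (AM : atlas R M m)
      (al be : P * M -> B) z,
    atlas_ok AM -> smooth_family AM AB al z -> smooth_family AM AB be z -> D (al z, be z) ->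
    smooth_family AM AB (fun y => q (al y, be y)) z;
  tr_T_smooth : forall (P M : topologicalType) m (AM : atlas R M m)
      (al be : P * M -> B) (ep : P * M -> E) z,
    atlas_ok AM -> smooth_family AM AB al z -> smooth_family AM AB be z ->
    smooth_family AM AE ep z -> D (al z, be z) ->
    (\forall y \near z, p (ep y) = al y) ->
    smooth_family AM AE (fun y => T (al y, be y) (ep y)) z;
  tr_S_smooth : forall (P M : topologicalType) m (AM : atlas R M m)
      (al be : P * M -> B) (ep : P * M -> E) z,
    atlas_ok AM -> smooth_family AM AB al z -> smooth_family AM AB be z ->
    smooth_family AM AE ep z -> D (al z, be z) ->
    (\forall y \near z, p (ep y) = q (al y, be y)) ->
    smooth_family AM AE (fun y => S (al y, be y) (ep y)) z }.

Let okE := manifold_atlas_ok mE.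
Let okB := manifold_atlas_ok mB.

Lemma transport0 : transport set0 setT fst (fun _ x => x) (fun _ x => x).
Proof. by split=> //; exact: openT. Qed.

Lemma proj_smooth_family {P M : topologicalType} {m : nat} (AM : atlas R M m) (ep : P * M -> E) z :
  atlas_ok AM -> smooth_family AM AE ep z -> smooth_family AM AB (fun y => p (ep y)) z.
Proof.
move=> okM sep; apply: (@smooth_family_comp _ _ _ _ _ _ _ _ _ _ _ okM okE ep (fun y => p y.2) z sep).
by apply: (family_of_smooth okE okB (W := setT)) => //; [exact: openT|case: hp].
Qed.

Lemma proj_continuous x : p @ x --> p x.
Proof. by have [[pc _] _] := hp; exact: (within_open_cvg openT pc). Qed.

(** The elementary move in the fibres: in a trivialization the fibre coordinate of [ep y] is kept
    and its base point is replaced by [b1 y]. *)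
Lemma move_smooth (U : set B) k (F : topologicalType) (AF : atlas R F k)
    (t : E -> B * F) (s : B * F -> E) (P M : topologicalType) m (AM : atlas R M m)
    (b1 : P * M -> B) (ep : P * M -> E) z :
  open U -> manifold_with_corners AF ->
  smooth_on AE (atlas_prod AB AF) (p @^-1` U) t ->
  smooth_on (atlas_prod AB AF) AE (U `*` [set: F]) s ->
  atlas_ok AM -> smooth_family AM AB b1 z -> smooth_family AM AE ep z -> U (p (ep z)) -> U (b1 z) ->
  smooth_family AM AE (fun y => s (b1 y, (t (ep y)).2)) z.
Proof.
move=> oU mF st ss okM sb1 sep Upz Ub1; have okF := manifold_atlas_ok mF.
have okBF := atlas_prod_ok okB okF.
have opU : open (p @^-1` U).
  by apply: open_comp => // x _; exact: proj_continuous.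
have oUF : open (U `*` [set: F]).
  rewrite openE => -[b y] [/= Ub _]; exists (U, [set: F]) => //.
  by split; [exact: open_nbhs_nbhs|exact: filterT].
have ste : smooth_family AM (atlas_prod AB AF) (fun y => t (ep y)) z.
  apply: (@smooth_family_comp _ _ _ _ _ _ _ _ _ _ _ okM okE ep (fun y => t y.2) z sep).
  exact: (family_of_smooth okE okBF opU).
have st2 := smooth_family_snd_of_prod okB ste.
apply: (@smooth_family_comp _ _ _ _ _ _ _ _ _ _ _ okM okBF
  (fun y => (b1 y, (t (ep y)).2)) (fun y => s y.2) z (smooth_family_pair sb1 st2)).
exact: (family_of_smooth okBF okE oUF).
Qed.

(** One more move is appended after [T]: over [X] the target has been reached and the point stays,
    over [W] the move goes all the way; the inverse undoes the new move before applying [S]. [W]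
    depends on [b0] alone, so that a finite cover can be chosen before anything is composed. *)
Lemma transport_step (b0 : B) : exists2 W : set B, nbhs b0 W & forall X D q T S,
  transport X D q T S -> exists D' q' T' S', transport (X `|` W) D' q' T' S'.
Proof.
have [_ /(_ b0) [U [k [F [AF [t [s [[oU Ub0] [[mF _] _] tK sK [st ss]]]]]]]]] := hp.
have [C [V [W [mid [clC [oV VU] CV [nW WC] [midV midC midK midW mid_smooth]]]]]] :=
  chart_step mB (open_nbhs_nbhs (conj oU Ub0)).
exists W => // X D q T S tr.
(* The condition is open because [C] is closed and [V] is open, and it holds on the diagonal because
   [C] lies in [V]. *)
pose D' := [set ab | D ab /\ (C ab.1 -> V (q ab) /\ V ab.2)].
pose q' ab := mid ab.1 (q ab) ab.2.
(* The inverse of this move is the same map with the old base point as target. *)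
pose mv (a b1 : B) (x : E) := if a \in C then s (b1, (t x).2) else x.
have mvP a b b1 x : p x = b -> (C a -> V b) -> (C a -> V b1) -> (~ C a -> b1 = b) ->
    p (mv a b1 x) = b1 /\ mv a b (mv a b1 x) = x.
  move=> pxb Vb Vb1 b1b; rewrite /mv; case: ifPn => [/set_mem Ca|/negP nC].
    have Ub1 : U b1 by apply: VU; exact: Vb1.
    have Upx : U (p x) by rewrite pxb; apply: VU; exact: Vb.
    have [-> ->] := sK (b1, (t x).2) Ub1; split=> //=.
    by have [tx stx] := tK x Upx; rewrite -pxb -tx -surjective_pairing stx.
  by split=> //; rewrite b1b // => Ca; apply: nC; exact: mem_set.
have mv_smooth (P M : topologicalType) m (AM : atlas R M m) (al b1 : P * M -> B)
    (ep : P * M -> E) z :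
    atlas_ok AM -> smooth_family AM AB al z -> smooth_family AM AB b1 z -> smooth_family AM AE ep z ->
    (C (al z) -> V (p (ep z)) /\ V (b1 z)) ->
    (\forall y \near z, ~ C (al y) -> b1 y = p (ep y)) ->
    smooth_family AM AE (fun y => mv (al y) (b1 y) (ep y)) z.
  move=> okM sal sb1 sep CVz nb1; have spe := proj_smooth_family okM sep.
  have [Ca|nCa] := pselect (C (al z)); last first.
    apply: (eq_smooth_family okM (F := ep)) => //.
    have : \forall y \near z, (~` C) (al y).
      apply: (near_cvg (proj1 sal)); apply: open_nbhs_nbhs; split=> //.
      exact: closed_openC.
    by apply: filterS => y nCy; rewrite /mv memNset.
  have [Vpz Vb1] := CVz Ca.
  apply: (eq_smooth_family okM (F := fun y => s (b1 y, (t (ep y)).2))); last first.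
    by apply: (move_smooth oU mF st ss okM sb1 sep); exact: VU.
  have nU : \forall y \near z, U (p (ep y)).
    apply: (near_cvg (proj1 spe)); apply: open_nbhs_nbhs; split=> //; exact: VU.
  (* Off [C] the target is the present base point, so the move through the trivialization is the
     identity and agrees with the other branch of [mv]. *)
  apply: filterS2 nb1 nU => y b1y Uy; rewrite /mv; case: ifPn => // /negP nC.
  rewrite b1y; last by move=> Cy; apply: nC; exact: mem_set.
  by have [tx stx] := tK _ Uy; rewrite -tx -surjective_pairing stx.
have qc (P M : topologicalType) m (AM : atlas R M m) (al be : P * M -> B) z :
    atlas_ok AM -> smooth_family AM AB al z -> smooth_family AM AB be z -> D (al z, be z) ->
    smooth_family AM AB (fun y => q (al y, be y)) z by exact: tr_q_smooth tr _ _ _ _ _ _ _.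
have near_D (P M : topologicalType) m (AM : atlas R M m) (al be : P * M -> B) z :
    smooth_family AM AB al z -> smooth_family AM AB be z -> D (al z, be z) ->
    \forall y \near z, D (al y, be y).
  move=> sal sbe Dz.
  have abc : (fun y => (al y, be y)) @ z --> (al z, be z).
    by apply: cvg_to_pair; [exact: (proj1 sal)|exact: (proj1 sbe)].
  by apply: (near_cvg abc); apply: open_nbhs_nbhs; split=> //; exact: tr_open tr.
have q'C ab : ~ C ab.1 -> q' ab = q ab by move=> /midC; apply.
have q'V ab : D' ab -> C ab.1 -> V (q' ab).
  by move=> [_ CVab] Ca; have [? ?] := CVab Ca; exact: midV.
have q'_smooth (P M : topologicalType) m (AM : atlas R M m) (al be : P * M -> B) z :
    atlas_ok AM -> smooth_family AM AB al z -> smooth_family AM AB be z -> D' (al z, be z) ->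
    smooth_family AM AB (fun y => q' (al y, be y)) z.
  move=> okM sal sbe [Dz CVz]; apply: mid_smooth => //.
  exact: (tr_q_smooth tr okM sal sbe Dz).
exists D', q', (fun ab x => mv ab.1 (q' ab) (T ab x)), (fun ab y => S ab (mv ab.1 (q ab) y)).
split.
- rewrite openE => -[a b] [Dab CVab].
  have sa : smooth_family AB AB (fun y : B * B => y.1) (a, b).
    by apply: (@smooth_family_param _ _ _ _ _ _ _ okB _ idfun) => x; exact: cvg_id.
  have sb : smooth_family AB AB (fun y : B * B => y.2) (a, b).
    by have [_ _ _ _ tB] := mB;
      apply: (family_of_smooth okB okB (W := setT) (f := idfun)) => //; exact: openT.
  have nD : \forall y \near (a, b), D y by apply: open_nbhs_nbhs; split=> //; exact: tr_open tr.
  have [Ca|nCa] := pselect (C a); last first.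
    have nC : \forall y \near (a, b), (~` C) y.1.
      apply: (near_cvg (proj1 sa)); apply: open_nbhs_nbhs; split=> //; exact: closed_openC.
    by apply: filterS2 nD nC => y Dy nCy; split.
  have [Vq Vb] := CVab Ca.
  have sq := tr_q_smooth tr okB sa sb Dab.
  have nVq : \forall y \near (a, b), V (q (y.1, y.2)).
    by apply: (near_cvg (proj1 sq)); exact: open_nbhs_nbhs.
  have nVb : \forall y \near (a, b), V y.2.
    by apply: (near_cvg (proj1 sb)); exact: open_nbhs_nbhs.
  by apply: filterS3 nD nVq nVb => -[a' b'] /= Dy Vqy Vby; split.
- move=> a; split; first exact: tr_diag tr a.
  by rewrite (tr_q_diag tr) /= => /CV.
- by move=> a; rewrite /q' (tr_q_diag tr) /=; apply: midK => /CV.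
- move=> ab [Dab CVab] [Xa|Wa]; rewrite /q'.
    by rewrite (tr_q_eq tr Dab Xa); apply: midK => /CVab [].
  by apply: midW => //; case: (CVab (WC _ Wa)).
- move=> ab x D'ab pxa; have [Dab CVab] := D'ab.
  have [pT TK] := tr_T tr Dab pxa.
  have [|||pmv mvK] := mvP ab.1 (q ab) (q' ab) (T ab x) pT.
  + by move=> /CVab [].
  + exact: q'V.
  + exact: q'C.
  by rewrite mvK.
- move=> ab y D'ab pyq; have [Dab CVab] := D'ab.
  have [|||pmv mvK] := mvP ab.1 (q' ab) (q ab) y pyq.
  + exact: q'V.
  + by move=> /CVab [].
  + by move=> /q'C.
  by have [pS SK] := tr_S tr Dab pmv; rewrite SK.
- move=> x; rewrite (tr_T_diag tr) /q' (tr_q_diag tr) /=.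
  rewrite midK; last by move=> /CV.
  rewrite /mv; case: ifPn => // /set_mem /CV /VU Upx.
  by have [tx stx] := tK x Upx; rewrite -tx -surjective_pairing stx.
- exact: q'_smooth.
- move=> P M m AM al be ep z okM sal sbe sep D'z pal; have [Dz CVz] := D'z.
  have sT := tr_T_smooth tr okM sal sbe sep Dz pal.
  have nD := near_D _ _ _ _ _ _ _ sal sbe Dz.
  have [pTz _] := tr_T tr Dz (nbhs_singleton pal).
  apply: (mv_smooth _ _ _ AM al (fun y => q' (al y, be y)) (fun y => T (al y, be y) (ep y))) => //.
  + exact: q'_smooth.
  + by move=> Cz; rewrite pTz; split; [case: (CVz Cz)|exact: q'V].
  + apply: filterS2 nD pal => y Dy paly nCy.
    by have [-> _] := tr_T tr Dy paly; exact: q'C.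
- move=> P M m AM al be ep z okM sal sbe sep D'z pal; have [Dz CVz] := D'z.
  have nD := near_D _ _ _ _ _ _ _ sal sbe Dz.
  have sq := tr_q_smooth tr okM sal sbe Dz.
  have sq' := q'_smooth _ _ _ _ _ _ _ okM sal sbe D'z.
  have nD' : \forall y \near z, C (al y) -> V (q (al y, be y)) /\ V (be y).
    have [Ca|nCa] := pselect (C (al z)); last first.
      have nC : \forall y \near z, (~` C) (al y).
        apply: (near_cvg (proj1 sal)); apply: open_nbhs_nbhs; split=> //; exact: closed_openC.
      by apply: filterS nC => y nCy.
    have [Vq Vb] := CVz Ca.
    have nVq : \forall y \near z, V (q (al y, be y)).
      by apply: (near_cvg (proj1 sq)); exact: open_nbhs_nbhs.
    have nVb : \forall y \near z, V (be y).
      by apply: (near_cvg (proj1 sbe)); exact: open_nbhs_nbhs.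
    by apply: filterS2 nVq nVb => y Vqy Vby.
  apply: (tr_S_smooth tr okM sal sbe _ Dz (ep := fun y => mv (al y) (q (al y, be y)) (ep y))).
    apply: (mv_smooth _ _ _ AM al (fun y => q (al y, be y)) ep) => //.
      move=> Cz; rewrite (nbhs_singleton pal); split; first exact: q'V.
      by case: (CVz Cz).
    by apply: filterS pal => y -> nC; rewrite q'C.
  apply: filterS3 nD nD' pal => y Dy CVy paly.
  have [|||pmv mvK] := mvP (al y) (q' (al y, be y)) (q (al y, be y)) (ep y) paly => //.
  + by move=> Cy; apply: q'V => //; split.
  + by move=> /CVy [].
  + by move=> nC; rewrite q'C.
Qed.

Lemma transport_sub X Y D q T S : X `<=` Y -> transport Y D q T S -> transport X D q T S.
Proof.
by move=> XY []; split=> //; move=> ab Dab /XY; eauto.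
Qed.

Lemma transport_compact (K : set B) : compact K -> exists D q T S, transport K D q T S.
Proof.
move=> /compact_near_coveringP cK.
have /choice [W WP] : forall b0 : B, exists W : set B, nbhs b0 W /\ forall X D q T S,
    transport X D q T S -> exists D' q' T' S', transport (X `|` W) D' q' T' S'.
  by move=> b0; have [W ? ?] := transport_step b0; exists W.
(* Finite lists ordered by inclusion: for this filter the near-covering form of compactness yields a
   finite subcover. *)
have FF : Filter (filter_from setT (fun r : seq B => [set s : seq B | {subset r <= s}])).
  apply: filter_from_filter; first by exists [::].
  move=> r r' _ _; exists (r ++ r') => // s rs; split=> b br; apply: rs.
    by rewrite mem_cat br.
  by rewrite mem_cat br orbT.
have [|D _ KD] := cK (seq B) _ (fun (s : seq B) (b : B) => exists2 b0, b0 \in s & W b0 b) FF.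
  move=> b _; exists (W b, [set s : seq B | b \in s]) => /=.
    split; first by case: (WP b).
    by exists [:: b] => // s bs; apply: bs; rewrite mem_head.
  by move=> [b' s] [/= Wb' bs]; exists b.
have {}KD : K `<=` [set b | exists2 b0, b0 \in D & W b0 b] by exact: KD.
have [D' [q [T [S tr]]]] : exists D' q T S,
    transport [set b | exists2 b0, b0 \in D & W b0 b] D' q T S.
  elim: (D) => [|b0 s [D' [q [T [S tr]]]]].
    exists setT, fst, (fun _ x => x), (fun _ x => x).
    by apply: transport_sub transport0 => b [].
  have [_ /(_ _ _ _ _ _ tr) [D'' [q' [T' [S' tr']]]]] := WP b0.
  exists D'', q', T', S'; apply: transport_sub tr' => b [b1].
  by rewrite inE => /predU1P[->|b1s] Wb; [right|left; exists b1].
by exists D', q, T, S; exact: transport_sub tr.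
Qed.

End Transport.

(** * Lifting diffeomorphisms of the base *)

Lemma continuous_set_val {T Y : topologicalType} (A : set Y) (F : T -> A) :
  continuous (fun t => set_val (F t)) -> continuous F.
Proof. exact: continuous_comp_initial. Qed.

Lemma set_val_continuous {Y : topologicalType} (A : set Y) :
  continuous (set_val : A -> Y).
Proof. exact: initial_continuous. Qed.

Lemma set_val_inj {Y : Type} (A : set Y) (a b : A) : set_val a = set_val b -> a = b.
Proof. exact: val_inj. Qed.

Section Diffeos.
Context {R : realType} {M : topologicalType} {m : nat} (A : atlas R M m).
Hypothesis okA : atlas_ok A.

Lemma diffeo_eq (f g : diffeo A) : (forall x, f x = g x) -> f = g.
Proof.
case: f g => [f fP] [g gP] /= fg; have E : f = g by apply/funext.
by move: fP gP; rewrite E => fP gP; rewrite (Prop_irrelevance fP gP).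
Qed.

Lemma diffeo_inv (f : diffeo A) : exists g : diffeo A, cancel f g /\ cancel g f.
Proof.
have [sf [g sg [fK gK]]] := diffeoP f.
have gP : smooth_on A A [set: M] g /\
    exists2 h : M -> M, smooth_on A A [set: M] h & cancel g h /\ cancel h g.
  by split=> //; exists f.
by exists (Diffeo gP).
Qed.

(** Single maps are handled as families over the dummy parameter space [R], evaluated at [0]. *)
Lemma diffeo_of_smooth_family (F G : R * M -> M) :
  (forall z, smooth_family A A F z) -> (forall z, smooth_family A A G z) ->
  (forall x, G (0, F (0, x)) = x) -> (forall x, F (0, G (0, x)) = x) ->
  exists f : diffeo A, forall x, f x = F (0, x).
Proof.
move=> sF sG FK GK.
have P : smooth_on A A [set: M] (fun x => F (0, x)) /\
    exists2 g : M -> M, smooth_on A A [set: M] g &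
      cancel (fun x => F (0, x)) g /\ cancel g (fun x => F (0, x)).
  split; first exact: smooth_of_family.
  by exists (fun x => G (0, x)) => //; exact: smooth_of_family.
by exists (Diffeo P).
Qed.

Lemma cst_diffeo_smooth_family {P : topologicalType} (f : diffeo A) (z : P * M) :
  smooth_family A A (fun y => f y.2) z.
Proof.
by have [sf _] := diffeoP f; apply: (family_of_smooth okA okA (W := setT)) => //; exact: openT.
Qed.

End Diffeos.

(** * Fibre-preserving diffeomorphisms and the maps they cover *)

Section Bundle.
Context {R : realType} {E B : topologicalType} {e n : nat}.
Variables (AE : atlas R E e) (AB : atlas R B n) (p : E -> B).
Hypotheses (mE : manifold_with_corners AE) (mB : manifold_with_corners AB).
Hypothesis hp : smooth_bundle_with_compact_fiber AE AB p.
Hypothesis p_onto : forall b, exists x, p x = b.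
Let okE := manifold_atlas_ok mE.
Let okB := manifold_atlas_ok mB.

Definition covers (g : diffeo AE) (f : diffeo AB) := forall x, p (g x) = f (p x).

Lemma covers_uniq g f f' : covers g f -> covers g f' -> f = f'.
Proof. by move=> gf gf'; apply: diffeo_eq => b; have [x <-] := p_onto b; rewrite -gf gf'. Qed.

Lemma covers_fiber g f : covers g f -> Diff_fiber AE p g.
Proof.
move=> gf b; exists (f b); apply/seteqP; split => [_ [x /= <- <-]|y /= pyfb]; first exact: gf.
have [g' [gK g'K]] := diffeo_inv g; have [f' [fK _]] := diffeo_inv f.
by exists (g' y); rewrite //= -[LHS]fK -gf g'K pyfb fK.
Qed.

Lemma fiber_proj (g : diffeo AE) x y : Diff_fiber AE p g -> p x = p y -> p (g x) = p (g y).
Proof.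
move=> gF pxy; have [b' gb] := gF (p x).
have gx : (g @` (p @^-1` [set p x])) (g x) by exists x.
have gy : (g @` (p @^-1` [set p x])) (g y) by exists y.
by rewrite gb /= in gx gy; rewrite gx gy.
Qed.

(** A point [y] over [b'] exists by surjectivity of [p], and [g (g' y) = y] identifies the fibre
    onto which [g] maps the one through [g' y]. *)
Lemma fiber_inv (g g' : diffeo AE) : cancel g g' -> cancel g' g -> Diff_fiber AE p g ->
  Diff_fiber AE p g'.
Proof.
move=> gK g'K gF b'; have [y pyb'] := p_onto b'.
exists (p (g' y)); have [b'' gb] := gF (p (g' y)).
have b'E : b'' = b'.
  have : (g @` (p @^-1` [set p (g' y)])) (g (g' y)) by exists (g' y).
  by rewrite gb g'K /= pyb'.
rewrite b'E in gb; apply/seteqP; split => [_ [z /= pz <-]|x /= px].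
  have : (p @^-1` [set b']) z by [].
  by rewrite -gb => -[x /= <- <-]; rewrite gK.
exists (g x) => //=.
have : (g @` (p @^-1` [set p (g' y)])) (g x) by exists x.
by rewrite gb.
Qed.

(** In a trivialization the fibre coordinate of one point [x0] over [b0] is kept constant. *)
Lemma local_section b0 : exists sec : B -> E, (\forall b \near b0, p (sec b) = b) /\
  forall (P : topologicalType) (q : P), smooth_family AB AE (fun y => sec y.2) (q, b0).
Proof.
have [_ /(_ b0) [U [k [F [AF [t [s [[oU Ub0] [[mF _] _] tK sK [st ss]]]]]]]]] := hp.
have [x0 px0] := p_onto b0.
exists (fun b => s (b, (t x0).2)); split.
  have nU : \forall b \near b0, U b by exact: open_nbhs_nbhs.
  by apply: filterS nU => b Ub; have [] := sK (b, (t x0).2) Ub.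
move=> P q.
apply: (@move_smooth _ _ _ _ _ AE AB p mE mB hp U k F AF t s P B n AB snd (fun=> x0)
   (q, b0) oU mF st ss okB) => //.
- have [_ _ _ _ tB] := mB.
  by apply: (family_of_smooth okB okB (W := setT) (f := idfun)) => //; exact: openT.
- by apply: (@smooth_family_param _ _ _ _ _ AB _ okE _ (fun=> x0)) => y; exact: cvg_cst.
- by rewrite /= px0.
Qed.

End Bundle.

Section InducedMap.
Context {R : realType} {E B : topologicalType} {e n : nat}.
Variables (AE : atlas R E e) (AB : atlas R B n) (p : E -> B).
Hypotheses (mE : manifold_with_corners AE) (mB : manifold_with_corners AB).
Hypothesis hp : smooth_bundle_with_compact_fiber AE AB p.
Hypothesis p_onto : forall b, exists x, p x = b.
Let okE := manifold_atlas_ok mE.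
Let okB := manifold_atlas_ok mB.

(** Near a point of the base, [f] is [p] after [G] after a local section. With a constant family
    this makes an induced map smooth; with the tautological family it makes the passage to induced
    maps continuous. *)
Lemma induced_smooth_family {P : topologicalType} (G : P -> diffeo AE) (f : P -> B -> B) z :
  continuous G -> (forall q x, p (G q x) = f q (p x)) ->
  smooth_family AB AB (fun y => f y.1 y.2) z.
Proof.
move=> Gc Gf; case: z => q b0.
have [sec [nsec ssec]] := local_section mE mB hp p_onto b0.
have nsec' : \forall y \near (q, b0), p (sec y.2) = y.2.
  by apply: (near_snd (Q := fun b => p (sec b) = b)).
apply: (eq_smooth_family okB (F := fun y => p (G y.1 (sec y.2)))).
  by apply: filterS nsec' => y sy; rewrite Gf sy.
apply: (proj_smooth_family mE mB hp okB (ep := fun y => G y.1 (sec y.2))).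
apply: (@smooth_family_comp _ _ _ _ _ _ _ _ _ _ _ okB okE (fun y => sec y.2)
  (fun y => G y.1 y.2) (q, b0) (ssec _ q)).
exact: diffeo_smooth_family.
Qed.

Lemma induced_diffeo (g : diffeo AE) : Diff_fiber AE p g -> exists f, @covers _ _ _ _ _ AE AB p g f.
Proof.
move=> gF; have [g' [gK g'K]] := diffeo_inv g.
have g'F := fiber_inv p_onto gK g'K gF.
(* An arbitrary section serves to define the induced map; its smoothness comes from the local
   sections. *)
have [sig sigK] := choice p_onto.
pose f b := p (g (sig b)); pose f' b := p (g' (sig b)).
have gf x : p (g x) = f (p x) by apply: fiber_proj => //; rewrite sigK.
have gf' x : p (g' x) = f' (p x) by apply: fiber_proj => //; rewrite sigK.
have [||b|b|h hf] := diffeo_of_smooth_family okB (F := fun y => f y.2) (G := fun y => f' y.2).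
- by move=> z; apply: (@induced_smooth_family R (fun=> g) (fun=> f)) => // q; exact: cvg_cst.
- by move=> z; apply: (@induced_smooth_family R (fun=> g') (fun=> f')) => // q; exact: cvg_cst.
- by rewrite /= -(sigK b) -gf -gf' gK.
- by rewrite /= -(sigK b) -gf' -gf g'K.
by exists h => x; rewrite hf.
Qed.

(** * Transporting fibre-preserving diffeomorphisms to another base map *)

Section Lifts.
Variables (X : set B) (D : set (B * B)) (q : B * B -> B) (T S : B * B -> E -> E).
Hypothesis tr : transport AE AB p X D q T S.

(** Says that [T (f0 b, f b)] is defined and really ends in the fibre over [f b]. *)
Definition reachable (f0 f : B -> B) :=
  forall b, D (f0 b, f b) /\ q (f0 b, f b) = f b.

Lemma pull_smooth_family {P : topologicalType} (f0 : diffeo AB) (f : P -> diffeo AB)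
    (g : P -> diffeo AE) z :
  continuous f -> continuous g -> (forall r, covers p (g r) (f r)) ->
  (forall r, reachable f0 (f r)) ->
  smooth_family AE AE (fun y => S (f0 (p y.2), f y.1 (p y.2)) (g y.1 y.2)) z.
Proof.
move=> fc gc gf f0f; have [_ _ _ _ tE] := mE.
have sid : smooth_family AE AE (fun y : P * E => y.2) z.
  by apply: (family_of_smooth okE okE (W := setT) (f := idfun)) => //; exact: openT.
have sp := proj_smooth_family mE mB hp okE sid.
apply: (tr_S_smooth tr okE (al := fun y => f0 (p y.2)) (be := fun y => f y.1 (p y.2))
  (ep := fun y => g y.1 y.2)).
- apply: (@smooth_family_comp _ _ _ _ _ _ _ _ _ _ _ okE okB (fun y => p y.2) (fun y => f0 y.2) z sp).
  exact: cst_diffeo_smooth_family.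
- apply: (@smooth_family_comp _ _ _ _ _ _ _ _ _ _ _ okE okB (fun y => p y.2) (fun y => f y.1 y.2) z sp).
  exact: diffeo_smooth_family.
- exact: diffeo_smooth_family.
- by case: (f0f z.1 (p z.2)).
- near=> y; rewrite gf; by case: (f0f y.1 (p y.2)).
Unshelve. all: by end_near. Qed.

Lemma push_smooth_family {P : topologicalType} (f0 : diffeo AB) (f : P -> diffeo AB)
    (g : P -> diffeo AE) z :
  continuous f -> continuous g -> (forall r, covers p (g r) f0) ->
  (forall r, reachable f0 (f r)) ->
  smooth_family AE AE (fun y => T (f0 (p y.2), f y.1 (p y.2)) (g y.1 y.2)) z.
Proof.
move=> fc gc gf f0f; have [_ _ _ _ tE] := mE.
have sid : smooth_family AE AE (fun y : P * E => y.2) z.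
  by apply: (family_of_smooth okE okE (W := setT) (f := idfun)) => //; exact: openT.
have sp := proj_smooth_family mE mB hp okE sid.
apply: (tr_T_smooth tr okE (al := fun y => f0 (p y.2)) (be := fun y => f y.1 (p y.2))
  (ep := fun y => g y.1 y.2)).
- apply: (@smooth_family_comp _ _ _ _ _ _ _ _ _ _ _ okE okB (fun y => p y.2) (fun y => f0 y.2) z sp).
  exact: cst_diffeo_smooth_family.
- apply: (@smooth_family_comp _ _ _ _ _ _ _ _ _ _ _ okE okB (fun y => p y.2) (fun y => f y.1 y.2) z sp).
  exact: diffeo_smooth_family.
- exact: diffeo_smooth_family.
- by case: (f0f z.1 (p z.2)).
- by near=> y; rewrite gf.
Unshelve. all: by end_near. Qed.

Lemma pull_diffeo (f0 f : diffeo AB) (g : diffeo AE) : covers p g f -> reachable f0 f ->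
  exists g0 : diffeo AE, covers p g0 f0 /\
    forall x, g0 x = S (f0 (p x), f (p x)) (g x).
Proof.
move=> gf f0f; have [g' [gK g'K]] := diffeo_inv g; have [f0' [f0K f0'K]] := diffeo_inv f0.
have SP x : p (S (f0 (p x), f (p x)) (g x)) = f0 (p x) /\
    T (f0 (p x), f (p x)) (S (f0 (p x), f (p x)) (g x)) = g x.
  have [Dx qx] := f0f (p x).
  by apply: (tr_S tr Dx); rewrite gf qx.
(* The inverse takes a point over [f0 b], where [b = f0' (p x)], moves it to the fibre over [f b],
   and then undoes [g]. *)
have [||x|x|g0 g0E] := diffeo_of_smooth_family okE
  (F := fun y => S (f0 (p y.2), f (p y.2)) (g y.2))
  (G := fun y => g' (T (p y.2, f (f0' (p y.2))) y.2)).
- by move=> z; apply: (@pull_smooth_family R f0 (fun=> f) (fun=> g)) => // r; exact: cvg_cst.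
- move=> z; have [_ _ _ _ tE] := mE.
  have sid : smooth_family AE AE (fun y : R * E => y.2) z.
    by apply: (family_of_smooth okE okE (W := setT) (f := idfun)) => //; exact: openT.
  have sp := proj_smooth_family mE mB hp okE sid.
  have sf0' : smooth_family AE AB (fun y : R * E => f0' (p y.2)) z.
    apply: (@smooth_family_comp _ _ _ _ _ _ _ _ _ _ _ okE okB (fun y => p y.2) (fun y => f0' y.2) z sp).
    exact: cst_diffeo_smooth_family.
  have sf : smooth_family AE AB (fun y : R * E => f (f0' (p y.2))) z.
    apply: (@smooth_family_comp _ _ _ _ _ _ _ _ _ _ _ okE okB (fun y => f0' (p y.2)) (fun y => f y.2) z sf0').
    exact: cst_diffeo_smooth_family.
  have sT : smooth_family AE AE (fun y : R * E => T (p y.2, f (f0' (p y.2))) y.2) z.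
    apply: (tr_T_smooth tr okE sp sf sid); last by near=> y.
    by have [+ _] := f0f (f0' (p z.2)); rewrite f0'K.
  apply: (@smooth_family_comp _ _ _ _ _ _ _ _ _ _ _ okE okE _ (fun y => g' y.2) z sT).
  exact: cst_diffeo_smooth_family.
- by have [/= -> SK] := SP x; rewrite f0K SK gK.
- rewrite /=; set b := f0' (p x); have [Db qb] := f0f b.
  have f0b : f0 b = p x by rewrite f0'K.
  rewrite f0b in Db qb.
  have [pT TK] := tr_T tr Db (erefl : p x = (p x, f b).1).
  have fp : f (p (g' (T (p x, f b) x))) = f b by rewrite -gf g'K pT qb.
  have [f' [fK _]] := diffeo_inv f.
  have pb : p (g' (T (p x, f b) x)) = b by rewrite -[LHS]fK fp fK.
  by rewrite g'K pb f0b TK.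
exists g0; split=> x; rewrite g0E //=.
by case: (SP x).
Unshelve. all: by end_near. Qed.

Lemma push_diffeo (f0 f : diffeo AB) (g0 : diffeo AE) : covers p g0 f0 -> reachable f0 f ->
  exists g : diffeo AE, covers p g f /\
    forall x, g x = T (f0 (p x), f (p x)) (g0 x).
Proof.
move=> g0f0 f0f; have [g' [gK g'K]] := diffeo_inv g0; have [f' [fK f'K]] := diffeo_inv f.
have TP x : p (T (f0 (p x), f (p x)) (g0 x)) = f (p x) /\
    S (f0 (p x), f (p x)) (T (f0 (p x), f (p x)) (g0 x)) = g0 x.
  have [Dx qx] := f0f (p x).
  by have [] := tr_T tr Dx (g0f0 x); rewrite qx.
(* The inverse takes a point over [f b], where [b = f' (p x)], moves it back to the fibre over
   [f0 b], and then undoes [g0]. *)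
have [||x|x|g gE] := diffeo_of_smooth_family okE
  (F := fun y => T (f0 (p y.2), f (p y.2)) (g0 y.2))
  (G := fun y => g' (S (f0 (f' (p y.2)), p y.2) y.2)).
- by move=> z; apply: (@push_smooth_family R f0 (fun=> f) (fun=> g0)) => // r; exact: cvg_cst.
- move=> z; have [_ _ _ _ tE] := mE.
  have sid : smooth_family AE AE (fun y : R * E => y.2) z.
    by apply: (family_of_smooth okE okE (W := setT) (f := idfun)) => //; exact: openT.
  have sp := proj_smooth_family mE mB hp okE sid.
  have sf' : smooth_family AE AB (fun y : R * E => f' (p y.2)) z.
    apply: (@smooth_family_comp _ _ _ _ _ _ _ _ _ _ _ okE okB (fun y => p y.2) (fun y => f' y.2) z sp).
    exact: cst_diffeo_smooth_family.
  have sf0 : smooth_family AE AB (fun y : R * E => f0 (f' (p y.2))) z.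
    apply: (@smooth_family_comp _ _ _ _ _ _ _ _ _ _ _ okE okB (fun y => f' (p y.2)) (fun y => f0 y.2) z sf').
    exact: cst_diffeo_smooth_family.
  have sS : smooth_family AE AE (fun y : R * E => S (f0 (f' (p y.2)), p y.2) y.2) z.
    apply: (tr_S_smooth tr okE sf0 sp sid).
      by have [+ _] := f0f (f' (p z.2)); rewrite f'K.
    by near=> y; have [_] := f0f (f' (p y.2)); rewrite f'K.
  apply: (@smooth_family_comp _ _ _ _ _ _ _ _ _ _ _ okE okE _ (fun y => g' y.2) z sS).
  exact: cst_diffeo_smooth_family.
- by have [/= -> TK] := TP x; rewrite fK TK gK.
- rewrite /=; set b := f' (p x); have [Db qb] := f0f b.
  have fb : f b = p x by rewrite f'K.
  rewrite fb in Db qb.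
  have [pS SK] := tr_S tr Db (esym qb : p x = q (f0 b, p x)).
  have fp : f0 (p (g' (S (f0 b, p x) x))) = f0 b by rewrite -g0f0 g'K pS.
  have [f0' [f0K _]] := diffeo_inv f0.
  have pb : p (g' (S (f0 b, p x) x)) = b by rewrite -[LHS]f0K fp f0K.
  by rewrite g'K pb fb SK.
exists g; split=> x; rewrite gE //=.
by case: (TP x).
Unshelve. all: by end_near. Qed.

End Lifts.

End InducedMap.

Lemma set_valP {Y : Type} (A : set Y) (a : A) : A (set_val a).
Proof. exact: set_mem (valP a). Qed.

Lemma set_val_ex {Y : Type} (A : set Y) y : A y -> exists a : A, set_val a = y.
Proof. by move=> Ay; exists (exist _ y (mem_set Ay)). Qed.

Lemma continuous_to_pair {T U V : topologicalType} (f : T -> U * V) :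
  continuous (fun t => (f t).1) -> continuous (fun t => (f t).2) -> continuous f.
Proof. by move=> f1 f2 t; apply: cvg_to_pair; [exact: f1|exact: f2]. Qed.

(** * The local trivialization *)

Section Main.
Context {R : realType} {E B : topologicalType} {e n : nat}.
Variables (AE : atlas R E e) (AB : atlas R B n) (p : E -> B) (K S : set B).
Hypotheses (mE : manifold_with_corners AE) (mB : manifold_with_corners AB).
Hypothesis hp : smooth_bundle_with_compact_fiber AE AB p.
Hypothesis p_onto : forall b, exists x, p x = b.
Hypothesis cK : compact K.
Let okE := manifold_atlas_ok mE.
Let okB := manifold_atlas_ok mB.

Local Notation DE := (Diff_fiber_rel AE p (p @^-1` K) (p @^-1` S)).
Local Notation DB := (Diff_rel AB K S).

Lemma induced_rel (g : DE) : exists f : DB, covers p (set_val g) (set_val f).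
Proof.
have [gF gr] := set_valP g.
have [f gf] := induced_diffeo mE mB hp p_onto gF.
have fr : DB f.
  move=> b bS; have [x pxb] := p_onto b; rewrite -pxb -gf gr //.
  by case: bS => [Sb|nKb]; [left|right]; rewrite /= pxb.
by have [f' f'E] := set_val_ex fr; exists f'; rewrite f'E.
Qed.

Lemma covers_rel (g : diffeo AE) (f : diffeo AB) : covers p g f ->
  (forall x, (S `|` ~` K) (p x) -> g x = x) -> DE g.
Proof.
move=> gf gr; split; first exact: covers_fiber gf.
by move=> x [Sx|nKx]; apply: gr; [left|right].
Qed.

(** An injective map that fixes the complement of [K] pointwise cannot send a point of [K] there.
    This matters because transport reaches its target when the starting point [f0 b] lies in [K]. *)
Lemma rel_stable (f0 : DB) b : K b -> K (set_val f0 b).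
Proof.
move=> Kb; apply: contrapT => nK; have f0r := set_valP f0.
have [f' [fK _]] := diffeo_inv (set_val f0).
have : set_val f0 (set_val f0 b) = set_val f0 b by apply: f0r; right.
by move/(can_inj fK) => f0b; apply: nK; rewrite f0b.
Qed.

(** Over [K], compactness and openness of the neighbourhood of the diagonal give uniform closeness;
    outside [K] both maps are the identity and the diagonal conditions of the transport apply. *)
Lemma reachable_near (f0 : DB) D q T S' : transport AE AB p K D q T S' ->
  nbhs f0 [set f : DB | reachable D q (set_val f0) (set_val f)].
Proof.
move=> tr.
have nD : \forall f \near f0, K `<=` [set b | D (set_val f0 b, (set_val (f : DB)) b)].
  have := cK; rewrite compact_near_coveringP => ncK.
  apply: (ncK _ (nbhs f0) (fun (f : DB) b => D (set_val f0 b, set_val f b))) => b Kb.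
  (* The inclusion of [DB] is itself a continuous family of diffeomorphisms, so evaluation is
     jointly continuous. *)
  have sf : smooth_family AB AB (fun y : DB * B => set_val y.1 y.2) (f0, b).
    by apply: diffeo_smooth_family => //; exact: set_val_continuous.
  have sf0 : smooth_family AB AB (fun y : DB * B => set_val f0 y.2) (f0, b).
    exact: cst_diffeo_smooth_family.
  have cD : (fun y : B * DB => (set_val f0 y.1, set_val y.2 y.1)) @ (b, f0) -->
      (set_val f0 b, set_val f0 b).
    have sw : (fun y : B * DB => (y.2, y.1)) @ (b, f0) --> (f0, b).
      by apply: cvg_to_pair => /=; [exact: cvg_snd|exact: cvg_fst].
    apply: cvg_to_pair => /=.
      exact: (cvg_comp _ _ sw (proj1 sf0)).
    exact: (cvg_comp _ _ sw (proj1 sf)).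
  have DD : \forall ab \near (set_val f0 b, set_val f0 b), D ab.
    by apply: open_nbhs_nbhs; split; [exact: tr_open tr|exact: (tr_diag tr)].
  exact: (near_cvg cD DD).
apply: filterS nD => f KD b.
have [Kb|nKb] := pselect (K b).
  have Db := KD b Kb; split=> //; apply: (tr_q_eq tr Db); exact: rel_stable.
have -> : set_val f0 b = b by apply: (set_valP f0); right.
have -> : set_val f b = b by apply: (set_valP f); right.
by split; [exact: (tr_diag tr)|exact: (tr_q_diag tr)].
Qed.

Lemma induced_continuous (ind : DE -> DB) :
  (forall g, covers p (set_val g) (set_val (ind g))) -> continuous ind.
Proof.
move=> indP; apply: continuous_set_val; apply: continuous_diffeo_smooth_family => // z.
apply: (@induced_smooth_family _ _ _ _ _ AE AB p mE mB hp p_onto DE set_val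
  (fun g => set_val (ind g))) => [|g x]; first exact: set_val_continuous.
exact: indP.
Qed.

Lemma induced_locally_trivial (ind : DE -> DB) :
  (forall g, covers p (set_val g) (set_val (ind g))) -> locally_trivial ind.
Proof.
move=> indP f0; have [D [q [T [S' tr]]]] := transport_compact mE mB hp cK.
pose U := [set f : DB | reachable D q (set_val f0) (set_val f)].
exists U; first exact: reachable_near tr.
have f0r := set_valP f0.
(* Where both base maps are the identity, transport does nothing, so the lifts keep fixing the
   points over [S] and outside [K]. *)
have T_id b x : p x = b -> T (b, b) x = x /\ S' (b, b) x = x.
  move=> <-; have Tx := tr_T_diag tr x; split=> //.
  by have [_] := tr_T tr (tr_diag tr (p x)) (erefl : p x = (p x, p x).1); rewrite Tx.
(* The two directions are given as relations because diffeomorphisms with these formulas are only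
   known to exist; choice turns them into maps, and the formulas carry all later computations. *)
pose pull (y : ind @^-1` U) (z : U * (ind @^-1` [set f0])) :=
  set_val z.1 = ind (set_val y) /\ forall x, set_val (set_val z.2) x =
    S' (set_val f0 (p x), set_val (ind (set_val y)) (p x)) (set_val (set_val y) x).
have /choice [h hP] : forall y, exists z, pull y z.
  move=> y; have Uy : U (ind (set_val y)) := set_valP y.
  have [g0 [g0f0 g0E]] := pull_diffeo mE mB hp tr (indP (set_val y)) Uy.
  have g0r : DE g0.
    apply: (covers_rel g0f0) => x xS; rewrite g0E.
    have -> : set_val f0 (p x) = p x by exact: f0r.
    have -> : set_val (ind (set_val y)) (p x) = p x by exact: (set_valP (ind (set_val y))).
    have [_ ->] : DE (set_val (set_val y)) := set_valP (set_val y); last first.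
      by case: xS => ?; [left|right].
    by case: (T_id (p x) x erefl).
  have [g g0K] := set_val_ex g0r.
  have indg : (ind @^-1` [set f0]) g.
    apply: set_val_inj; apply: (covers_uniq p_onto (indP g)).
    by rewrite g0K.
  have [u uE] := set_val_ex Uy; have [v vE] := set_val_ex indg.
  by exists (u, v); split=> //= x; rewrite vE g0K g0E.
pose push (z : U * (ind @^-1` [set f0])) (y : ind @^-1` U) :=
  ind (set_val y) = set_val z.1 /\ forall x, set_val (set_val y) x =
    T (set_val f0 (p x), set_val (set_val z.1) (p x)) (set_val (set_val z.2) x).
have zf0 (z : U * (ind @^-1` [set f0])) : covers p (set_val (set_val z.2)) (set_val f0).
  have indz : ind (set_val z.2) = f0 := set_valP z.2.
  by have := indP (set_val z.2); rewrite indz.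
have /choice [k kP] : forall z, exists y, push z y.
  move=> z; have Uz : U (set_val z.1) := set_valP z.1.
  have [g [gf gE]] := push_diffeo mE mB hp tr (zf0 z) Uz.
  have gr : DE g.
    apply: (covers_rel gf) => x xS; rewrite gE.
    have -> : set_val f0 (p x) = p x by exact: f0r.
    have -> : set_val (set_val z.1) (p x) = p x by exact: (set_valP (set_val z.1)).
    have [_ ->] : DE (set_val (set_val z.2)) := set_valP (set_val z.2); last first.
      by case: xS => ?; [left|right].
    by case: (T_id (p x) x erefl).
  have [g1 g1E] := set_val_ex gr.
  have indg : ind g1 = set_val z.1.
    apply: set_val_inj; apply: (covers_uniq p_onto (indP g1)).
    by rewrite g1E.
  have Ug : (ind @^-1` U) g1 by rewrite /= indg.
  have [y yE] := set_val_ex Ug.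
  by exists y; rewrite /push yE; split=> // x; rewrite g1E gE.
have indc := induced_continuous indP.
exists h, k; split.
- have c1 : continuous (fun y => (h y).1).
    apply: continuous_set_val.
    have -> : (fun y => set_val (h y).1) = ind \o set_val.
      by apply/funext => y; case: (hP y).
    by move=> y; apply: continuous_comp; [exact: set_val_continuous|exact: indc].
  have c2 : continuous (fun y => (h y).2).
    (* The component lies in a subtype of a subtype of [diffeo AE]. Its continuity reduces to
       smoothness of the explicit formula as a family with [y] as its parameter. *)
    apply: continuous_set_val; apply: continuous_set_val.
    apply: continuous_diffeo_smooth_family => // z.
    have -> : (fun y : (ind @^-1` U) * E => set_val (set_val (h y.1).2) y.2) =
      fun y => S' (set_val f0 (p y.2), set_val (ind (set_val y.1)) (p y.2))
        (set_val (set_val y.1) y.2).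
      by apply/funext => y; case: (hP y.1) => _ ->.
    apply: (pull_smooth_family mE mB hp tr (f := fun y : ind @^-1` U => set_val (ind (set_val y)))
       (g := fun y : ind @^-1` U => set_val (set_val y))).
    + move=> y; apply: continuous_comp; last exact: set_val_continuous.
      by apply: continuous_comp; [exact: set_val_continuous|exact: indc].
    + by move=> y; apply: continuous_comp; exact: set_val_continuous.
    + by move=> y; exact: indP.
    + by move=> y; exact: (set_valP y).
  exact: continuous_to_pair c1 c2.
- apply: continuous_set_val; apply: continuous_set_val.
  apply: continuous_diffeo_smooth_family => // z.
  have -> : (fun y : (U * (ind @^-1` [set f0])) * E => set_val (set_val (k y.1)) y.2) =
      fun y => T (set_val f0 (p y.2), set_val (set_val y.1.1) (p y.2))
        (set_val (set_val y.1.2) y.2).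
    by apply/funext => y; case: (kP y.1) => _ ->.
  apply: (push_smooth_family mE mB hp tr (f := fun y : U * (ind @^-1` [set f0]) => set_val (set_val y.1))
       (g := fun y : U * (ind @^-1` [set f0]) => set_val (set_val y.2))).
  + move=> y; apply: (@continuous_comp _ _ _ (fun y : U * (ind @^-1` [set f0]) => set_val y.1));
      last exact: set_val_continuous.
    by apply: continuous_comp; [exact: cvg_fst|exact: set_val_continuous].
  + move=> y; apply: (@continuous_comp _ _ _ (fun y : U * (ind @^-1` [set f0]) => set_val y.2));
      last exact: set_val_continuous.
    by apply: continuous_comp; [exact: cvg_snd|exact: set_val_continuous].
  + exact: zf0.
  + by move=> y; exact: (set_valP y.1).
- move=> y; apply: set_val_inj; apply: set_val_inj; apply: diffeo_eq => x.
  have [h1 h2] := hP y; have [k1 k2] := kP (h y); rewrite k2 h2 h1.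
  have [Dx qx] : D (set_val f0 (p x), set_val (ind (set_val y)) (p x)) /\ _ := set_valP y (p x).
  have [|_ //] := tr_S tr Dx (y := set_val (set_val y) x).
  by rewrite (indP (set_val y)) qx.
- move=> z; have [k1 k2] := kP z; have [h1 h2] := hP (k z).
  have E1 : (h (k z)).1 = z.1 by apply: set_val_inj; rewrite h1 k1.
  have E2 : (h (k z)).2 = z.2.
    apply: set_val_inj; apply: set_val_inj; apply: diffeo_eq => x; rewrite h2 k1 k2.
    have [Dx qx] := set_valP z.1 (p x).
    by have [] := tr_T tr Dx (zf0 z x).
  by rewrite [LHS]surjective_pairing E1 E2 -surjective_pairing.
- by move=> y; case: (hP y).
Qed.

End Main.

Theorem theorem3p3p6 (R : realType) (E B : topologicalType) (e n : nat)
    (AE : atlas R E e) (AB : atlas R B n) (p : E -> B) (K S : set B)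
    (hE : manifold_with_corners AE) (hB : manifold_with_boundary AB)
    (hp : smooth_bundle_with_compact_fiber AE AB p)
    (p_onto : forall b : B, exists x : E, p x = b)
    (hK : compact K) (hS : S `<=` boundary AB) :
  exists ind : Diff_fiber_rel AE p (p @^-1` K) (p @^-1` S) -> Diff_rel AB K S,
    (forall (g : Diff_fiber_rel AE p (p @^-1` K) (p @^-1` S)) (x : E),
       p (set_val g x) = set_val (ind g) (p x)) /\
    locally_trivial ind.
Proof.
have [mB _] := hB.
have [ind indP] := choice (@induced_rel R E B e n AE AB p K S hE mB hp p_onto).
by exists ind; split; [exact: indP|exact: induced_locally_trivial].
Qed.
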